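(* There exist positive universal constants $C_1, C_2$ such that for any $n\ge 1$, for any (Borel measurable) set $A\subset\mathbb{R}^n$, and for any $\rho\in(0,1)$, $$\mathrm{VAR}^{\mathcal G}(A,\rho)\ \le\ C_1\cdot\Big(\sum_{i=1}^n I_i^{\mathcal G}(A)^2\Big)^{C_2\rho^2}.$$
   Context: $\mu$ is the standard Gaussian measure on $\mathbb{R}$, $\mu(dx) = (1/\sqrt{2\pi})e^{-x^2/2}dx$, and $\mu^{\otimes n}$ is the product measure on $\mathbb{R}^n$. All sets are Borel measurable. For a Borel set $S \subseteq \mathbb{R}$, its lower Minkowski content is $\mu^{+}(S) := \liminf_{r\downarrow 0} \frac{\mu(S+[-r,r])-\mu(S)}{r}$. For a Borel set $A\subseteq\mathbb{R}^n$, $1\le i\le n$ and $x\in\mathbb{R}^n$, the fiber is $A_i^x := \{y\in\mathbb{R} : (x_1,\dots,x_{i-1},y,x_{i+1},\dots,x_n)\in A\}$. The geometric influence of the $i$-th coordinate on $A$ is $I_i^{\mathcal G}(A) := \mathbb{E}_x[\mu^{+}(A_i^x)]\in[0,\infty]$, where $x$ is distributed according to $\mu^{\otimes n}$. (If some influence is $+\infty$, the right-hand side is $+\infty$.) Let $W,W'$ be i.i.d. standard Gaussian vectors on $\mathbb{R}^n$ and $W^\rho=\sqrt{1-\rho^2}\,W+\rho W'$. For a set $A\subset\mathbb{R}^n$, $Z^{\mathcal G}(A,\rho)=\mathbb{E}[\mathbf{1}_A(W)\mathbf{1}_A(W^\rho)]$ and $\mathrm{VAR}^{\mathcal G}(A,\rho)=Z^{\mathcal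 G}(A,\rho)-\mu^{\otimes n}(A)^2$. *)

(* Defs.v *)
From HB Require Import structures.
From mathcomp Require Import all_boot all_order all_algebra.
From mathcomp Require Import all_classical all_reals all_analysis.
Set Implicit Arguments.
Unset Strict Implicit.
Unset Printing Implicit Defensive.
Import Order.TTheory GRing.Theory Num.Theory.
Import numFieldNormedType.Exports.
Local Open Scope classical_set_scope.
Local Open Scope ring_scope.


(* R^n: the sigma-algebra on tuples is generated by the n coordinate maps, i.e.
   it is the Borel sigma-algebra. *)
Notation euclid R n := (n.-tuple (measurableTypeR R)).

Section gaussian_space.
Variable R : realType.

Definition cons_coord n (p : measurableTypeR R * euclid R n) : euclid R n.+1 :=
  [tuple of p.1 :: p.2].

Lemma measurable_cons_coord n : measurable_fun setT (@cons_coord n).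
Proof. exact: measurable_cons. Qed.

HB.instance Definition _ n :=
  isMeasurableFun.Build _ _ _ _ (@cons_coord n) (@measurable_cons_coord n).

(* gaussian n.+1 is the image of normal_prob 0 1 \x gaussian n under the
   identification of R * R^n with R^n.+1; see gaussian_box below. *)
Fixpoint gaussian n : probability (euclid R n) R :=
  match n with
  | 0 => dirac ([tuple] : euclid R 0)
  | m.+1 => distribution (normal_prob 0 1 \x gaussian m)%E (@cons_coord m)
  end.

Lemma gaussian_box n (B : 'I_n -> set (measurableTypeR R)) :
  (forall i, measurable (B i)) ->
  gaussian n [set x | forall i, B i (tnth x i)] =
  (\prod_(i < n) normal_prob 0 1 (B i))%E.
Proof.
elim: n B => [|n IHn] B mB.
  by rewrite big_ord0 /= diracE mem_set//= => -[].
rewrite big_ord_recl -(IHn (fun i => B (lift ord0 i))) //=.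
rewrite /distribution /pushforward -product_measure1E//.
  congr (_ _); apply/seteqP; split=> [[a x] /= Bx|[a x] /= [Ba Bx] i].
    by split=> [|i]; [have := Bx ord0 | have := Bx (lift ord0 i)];
      rewrite ?tnth0 ?tnthS.
  by case: (unliftP ord0 i) => [j|] ->; rewrite ?tnth0 ?tnthS.
rewrite [X in measurable X](_ : _ =
    \bigcap_(i in [set: 'I_n]) ((@tnth n _)^~ i @^-1` B (lift ord0 i))).
  apply: fin_bigcap_measurable => //= i _.
  by rewrite -[X in measurable X]setTI; apply: measurable_tnth.
by apply/seteqP; split=> x /= Bx; [move=> i _; exact: Bx | move=> i; exact: Bx].
Qed.

Definition enlarge (S : set (measurableTypeR R)) (r : R) :
    set (measurableTypeR R) :=
  [set s + t | s in S & t in `[- r, r]].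

Definition minkowski_content (S : set (measurableTypeR R)) : \bar R :=
  limf_einf (fun r : R =>
    (normal_prob 0 1 (enlarge S r) - normal_prob 0 1 S) / r%:E)%E 0^'+.

Definition fiber n (A : set (euclid R n)) (i : 'I_n) (x : euclid R n) :
    set (measurableTypeR R) :=
  [set y | A [tuple if j == i then y else tnth x j | j < n]].

(* For Borel A, minkowski_content (fiber A i x) is in general measurable in x
   only for the completion of gaussian n (projections of Borel sets occur). The
   integral of a nonnegative function is here the supremum of the integrals of
   the Borel simple functions below it, which agrees with the integral for the
   completed measure. *)
Definition geometric_influence n (A : set (euclid R n)) (i : 'I_n) : \bar R :=
  (\int[gaussian n]_x minkowski_content (fiber A i x))%E.

(* w^rho, with w' the independent copy of w *)
Definition noisy n (rho : R) (w w' : euclid R n) : euclid R n :=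
  [tuple Num.sqrt (1 - rho ^+ 2) * tnth w j + rho * tnth w' j | j < n].

(* (W, W') is realized as the identity of R^n * R^n under the product law. *)
Definition Z_gauss n (A : set (euclid R n)) (rho : R) : \bar R :=
  (\int[gaussian n \x gaussian n]_p
     ((\1_A p.1 : R) * \1_A (noisy rho p.1 p.2))%:E)%E.

Definition VAR_gauss n (A : set (euclid R n)) (rho : R) : \bar R :=
  (Z_gauss A rho - gaussian n A ^+ 2)%E.

End gaussian_space.

(* Main.v *)
Require Import Defs.
From mathcomp Require Import all_boot all_order all_algebra.
From mathcomp Require Import all_classical all_reals all_analysis.
From mathcomp Require Import ring lra.
From mathcomp Require Import measurable_realfun.
Set Implicit Arguments.
Unset Strict Implicit.
Unset Printing Implicit Defensive.
Import Order.TTheory GRing.Theory Num.Theory.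
Import numFieldNormedType.Exports.
Local Open Scope classical_set_scope.
Local Open Scope ring_scope.

(** Let f be the indicator of A, let a be its mean, and let v (r) be the covariance of
    f (W) and f (W') for standard Gaussian vectors W and W' of correlation r. Then
    [VAR_gauss A rho] is v (r) for r = sqrt (1 - rho^2). The theorem follows from an
    inequality on the line, a bound on v (r) for small r, and a comparison of v (r) with v
    at powers of r.

    The geometry enters through the line only. A point of S and a point at distance at
    least r from S are separated by an interval of length r that the r-enlargement adds
    to S ([crossing_layer]). Averaging over the two points yields the Cheeger inequality
    mu (S) mu (~` S) <= c mu^+ (S) ([gaussian_cheeger]). Applied to the fibres of A, it bounds
    the influence J_i, the mean of |f (X) - f (X')| where X and X' differ by a resampling of
    the i-th coordinate, by 2 c I_i ([l1_influence_le_geometric]).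

    For r <= 1/4 the noise operator contracts L2 into L4, so the noise form of two functions
    is at most the product of their norms of exponents 4/3 and 2 ([hypercontractive]).
    Decompose f - a into the martingale increments obtained by averaging out the
    coordinates one after the other. The noise form is orthogonal on them; the L1 norm of
    the i-th one is at most J_i, and the squares of their L2 norms add up to the variance
    of f. Interpolating the exponents between 1 and 2 gives, for all lam > 0,
    v (r) <= lam^3 S + lam^-1 with S the sum of the J_i^2 ([noise_bound]), and the best lam
    gives v (r) <= 2 S^(1/4).

    For general r, v (r) is the pairing of f - a with its image under a symmetric operator
    whose square is the operator for r^2. The variance of f is at most 1, so Cauchy-Schwarz
    gives v (r)^2 <= v (r^2), hence v (r)^(2^k) <= v (r^(2^k)) ([noise_decay]). Since
    r^2 = 1 - rho^2, some k with 2^k rho^2 <= 12 brings r^(2^k) below 1/4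
    ([doubling_exponent]). Taking the root of order 2^k leaves the exponent 1 / (4 * 2^k),
    which is at least rho^2 / 48. *)

(** * Integrals of nonnegative functions *)

Section integral_tools.
Local Open Scope ereal_scope.

(** The integral of a nonnegative function is the supremum of the integrals of the
    simple functions below it, hence monotone on arbitrary functions. This is the form
    needed for the Minkowski content of a fibre, which may depend on the base point in a
    non-Borel way. *)
Lemma le_integral_nonmeasurable d (T : measurableType d) (R : realType)
    (mu : {measure set T -> \bar R}) (f g : T -> \bar R) :
  (forall x, 0 <= f x) -> (forall x, f x <= g x) ->
  \int[mu]_x f x <= \int[mu]_x g x.
Proof.
move=> f0 fg; have g0 x : 0 <= g x by exact: le_trans (f0 x) (fg x).
rewrite !ge0_integralTE//; apply: le_ereal_sup => _ [h hf <-]; exists h => //.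
by move=> x; exact: le_trans (hf x) (fg x).
Qed.

Lemma integral_indicT d (T : measurableType d) (R : realType)
    (mu : {measure set T -> \bar R}) (A : set T) :
  measurable A -> \int[mu]_x (\1_A x : R)%:E = mu A.
Proof. by move=> mA; rewrite integral_indic// setIT. Qed.

Lemma ge0_integralZlT d (T : measurableType d) (R : realType)
    (mu : {measure set T -> \bar R}) (f : T -> \bar R) (k : \bar R) :
  measurable_fun setT f -> (forall x, 0 <= f x) -> 0 <= k ->
  \int[mu]_x (k * f x) = k * \int[mu]_x f x.
Proof. by move=> mf f0 k0; rewrite ge0_integralZl. Qed.

Lemma ge0_integralDT d (T : measurableType d) (R : realType)
    (mu : {measure set T -> \bar R}) (f g : T -> \bar R) :
  measurable_fun setT f -> (forall x, 0 <= f x) ->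
  measurable_fun setT g -> (forall x, 0 <= g x) ->
  \int[mu]_x (f x + g x) = \int[mu]_x f x + \int[mu]_x g x.
Proof. by move=> mf f0 mg g0; rewrite ge0_integralD. Qed.

Section tonelli.
Context d1 d2 (T1 : measurableType d1) (T2 : measurableType d2) (R : realType).
Variables (m1 : {sigma_finite_measure set T1 -> \bar R})
  (m2 : {sigma_finite_measure set T2 -> \bar R}) (f : T1 -> T2 -> \bar R).
Hypothesis mf : measurable_fun setT (fun p : T1 * T2 => f p.1 p.2).
Hypothesis f0 : forall x y, 0 <= f x y.

Lemma tonelli : \int[m1]_x \int[m2]_y f x y = \int[m2]_y \int[m1]_x f x y.
Proof. exact: (fubini_tonelli (fun p : T1 * T2 => f p.1 p.2)). Qed.

Lemma tonelli_prod : \int[m1 \x m2]_p f p.1 p.2 = \int[m1]_x \int[m2]_y f x y.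
Proof. exact: (fubini_tonelli1 (fun p : T1 * T2 => f p.1 p.2)). Qed.

Lemma measurable_integralr : measurable_fun setT (fun x => \int[m2]_y f x y).
Proof.
exact: (measurable_fun_fubini_tonelli_F (fun p : T1 * T2 => f p.1 p.2)).
Qed.

Lemma measurable_integrall : measurable_fun setT (fun y => \int[m1]_x f x y).
Proof.
exact: (measurable_fun_fubini_tonelli_G (fun p : T1 * T2 => f p.1 p.2)).
Qed.

End tonelli.

Lemma tonelli3 d1 d2 d3 (T1 : measurableType d1) (T2 : measurableType d2)
    (T3 : measurableType d3) (R : realType)
    (m1 : {sigma_finite_measure set T1 -> \bar R})
    (m2 : {sigma_finite_measure set T2 -> \bar R})
    (m3 : {sigma_finite_measure set T3 -> \bar R}) (f : T1 -> T2 -> T3 -> \bar R) :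
  measurable_fun setT (fun q : (T1 * T2) * T3 => f q.1.1 q.1.2 q.2) ->
  (forall x y z, 0 <= f x y z) ->
  \int[m1]_x \int[m2]_y \int[m3]_z f x y z =
  \int[m3]_z \int[m1]_x \int[m2]_y f x y z.
Proof.
move=> mf f0.
have mf1 x : measurable_fun setT (fun q : T2 * T3 => f x q.1 q.2).
  have mg : measurable_fun setT (fun q : T2 * T3 => ((x, q.1), q.2)).
    by do 2 (apply: measurable_fun_pair => //).
  exact: measurableT_comp mf mg.
under eq_integral do rewrite tonelli//.
apply: tonelli => [|x z]; last exact: integral_ge0.
have mf2 : measurable_fun setT (fun q : (T1 * T3) * T2 => f q.1.1 q.2 q.1.2).
  have mg : measurable_fun setT (fun q : (T1 * T3) * T2 => ((q.1.1, q.2), q.1.2)).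
    apply: measurable_fun_pair; last exact: measurableT_comp.
    by apply: measurable_fun_pair => //; exact: measurableT_comp.
  exact: measurableT_comp mf mg.
exact: (measurable_integralr _ mf2).
Qed.

Lemma integral2_indic d1 d2 (T1 : measurableType d1) (T2 : measurableType d2)
    (R : realType) (m1 : {measure set T1 -> \bar R})
    (m2 : {measure set T2 -> \bar R}) (A : set T1) (B : set T2) :
  measurable A -> measurable B ->
  \int[m1]_x \int[m2]_y ((\1_A x)%:E * (\1_B y)%:E) = m1 A * m2 B.
Proof.
move=> mA mB.
have mi d (T : measurableType d) (C : set T) : measurable C ->
    measurable_fun setT (fun x => (\1_C x : R)%:E).
  by move=> mC; apply/measurable_EFinP; exact: measurable_indic.
under eq_integral => x _.
  rewrite ge0_integralZlT ?lee_fin//; [|exact: mi].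
  rewrite integral_indicT// muleC; over.
rewrite ge0_integralZlT//; [|exact: mi].
by rewrite integral_indicT// muleC.
Qed.

Lemma measurable_natr_bool d (T : measurableType d) (R : realType) (b : T -> bool) :
  measurable_fun setT b -> measurable_fun setT (fun x => (b x)%:R : R).
Proof.
move=> mb; have mB : measurable [set x | b x].
  by rewrite -[X in measurable X]setTI; exact: (mb measurableT [set true]).
rewrite (_ : (fun x => _) = \1_[set x | b x]); first exact: measurable_indic.
by apply/funext => x; rewrite indicE; congr (nat_of_bool _)%:R; apply/idP/idP; rewrite inE.
Qed.

Variable R : realType.
Local Notation leb := (@lebesgue_measure R).
Import HBNNSimple.

Lemma integral_normal_prob_indic (m s : R) (E : set R) : measurable E ->
  \int[normal_prob m s]_x (\1_E x)%:E =
  \int[leb]_x ((\1_E x)%:E * (normal_pdf m s x)%:E).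
Proof.
move=> mE; rewrite integral_indic// setIT.
transitivity (\int[leb]_(x in E) (normal_pdf m s x)%:E); first by [].
rewrite [LHS]integral_mkcond.
apply: eq_integral => x _; rewrite patchE indicE.
by case: ifPn; rewrite ?mul1e ?mul0e.
Qed.

Let mpdf (m s : R) : measurable_fun setT (fun x => (normal_pdf m s x)%:E).
Proof. by apply/measurable_EFinP; exact: measurable_normal_pdf. Qed.

Lemma integral_normal_prob_nnsfun (m s : R) (f : {nnsfun measurableTypeR R >-> R}) :
  \int[normal_prob m s]_x (f x)%:E =
  \int[leb]_x ((f x)%:E * (normal_pdf m s x)%:E).
Proof.
under [LHS]eq_integral do rewrite fimfunE -fsumEFin//.
rewrite [LHS]ge0_integral_fsum//; last 2 first.
  - by move=> r; exact/measurable_EFinP/measurableT_comp.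
  - by move=> n x _; rewrite EFinM nnfun_muleindic_ge0.
under [RHS]eq_integral.
  move=> x xD; rewrite fimfunE -fsumEFin// ge0_mule_fsuml; last first.
    by move=> r; rewrite EFinM nnfun_muleindic_ge0.
  over.
rewrite [RHS]ge0_integral_fsum//; last 2 first.
  - move=> r; apply: emeasurable_funM; last exact: mpdf.
    by apply/measurable_EFinP; exact/measurableT_comp.
  - move=> n x _; apply: mule_ge0; last by rewrite lee_fin normal_pdf_ge0.
    by rewrite EFinM nnfun_muleindic_ge0.
apply: eq_fsbigr => r _.
rewrite integralZl_indic_nnsfun//= integral_normal_prob_indic//.
have [r0|r0] := leP 0%R r.
  rewrite -ge0_integralZl//.
  - by apply: eq_integral => x _; rewrite EFinM muleA.
  - apply: emeasurable_funM; last exact: mpdf.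
    exact/measurable_EFinP/measurable_indic.
  - by move=> x _; rewrite mule_ge0// lee_fin ?normal_pdf_ge0.
have -> : f @^-1` [set r] = set0 by exact: preimage_nnfun0.
rewrite integral0_eq ?mule0; last by move=> x _; rewrite indic0 mul0e.
by rewrite integral0_eq// => x _; rewrite indic0 mulr0 mul0e.
by rewrite -[X in measurable X]setTI; exact: (measurable_funP f).
Qed.

(** On indicators this is the definition of [normal_prob]; linearity gives simple
    functions, and monotone convergence along an increasing sequence of simple functions
    gives the general case. *)
Lemma integral_normal_prob (m s : R) (f : measurableTypeR R -> \bar R) :
  measurable_fun setT f -> (forall x, 0 <= f x) ->
  \int[normal_prob m s]_x f x = \int[leb]_x (f x * (normal_pdf m s x)%:E).
Proof.
move=> mf f0; pose f_ := nnsfun_approx measurableT mf.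
have p0 x : 0 <= (normal_pdf m s x)%:E by rewrite lee_fin normal_pdf_ge0.
transitivity (limn (fun n => \int[normal_prob m s]_x (f_ n x)%:E)).
  rewrite -monotone_convergence//=.
  - apply: eq_integral => ? /[!inE] xD; apply/esym/cvg_lim => //=.
    exact: cvg_nnsfun_approx.
  - by move=> n; exact/measurable_EFinP/measurable_funTS.
  - by move=> n ? _; rewrite lee_fin.
  - by move=> ? _ ? ? mn; rewrite lee_fin; exact/lefP/nd_nnsfun_approx.
rewrite [RHS](_ : _ = limn (fun n =>
    \int[leb]_x ((f_ n x)%:E * (normal_pdf m s x)%:E))); last first.
  rewrite -monotone_convergence//=.
  - apply: eq_integral => x _; apply/esym/cvg_lim => //.
    apply: cvgeZr => //; exact: cvg_nnsfun_approx.
  - move=> n; apply: emeasurable_funM; last exact: mpdf.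
    exact/measurable_EFinP/measurable_funTS.
  - by move=> n x _; rewrite mule_ge0// lee_fin.
  - move=> x _ ? ? mn; rewrite lee_wpmul2r// lee_fin.
    exact/lefP/nd_nnsfun_approx.
by apply: congr_lim; apply/funext => n /=; exact: integral_normal_prob_nnsfun.
Qed.

Definition affine (a s : R) (u : measurableTypeR R) : measurableTypeR R :=
  (a + s * u)%R.

Lemma measurable_affine (a s : R) : measurable_fun setT (affine a s).
Proof. by apply: measurable_funD => //; exact: measurable_funM. Qed.

(** The factor s compensates the contraction of lengths by [affine a s] on preimages,
    so that this measure is the Lebesgue measure again ([affine_lebesgueE]). *)
Definition affine_lebesgue (a s : R) (s0 : (0 < s)%R) :
    {measure set (measurableTypeR R) -> \bar R} :=
  mscale (NngNum (ltW s0))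
    (measure_function_pushforward__canonical__measure_function_Measure
       leb (measurable_affine a s)).

Lemma affine_lebesgueE (a s : R) (s0 : (0 < s)%R) (A : set (measurableTypeR R)) :
  measurable A -> leb A = affine_lebesgue a s0 A.
Proof.
apply: lebesgue_measure_unique.
move=> _ [[x y] _ <-] /=.
rewrite /affine_lebesgue /mscale/= /pushforward.
have -> : affine a s @^-1` `]x, y]%classic = `]((x - a) / s)%R, ((y - a) / s)%R]%classic.
  by apply/seteqP; split => u /=; rewrite /affine !in_itv/= ltr_pdivrMr//
    ler_pdivlMr// ltrBlDl lerBrDl (mulrC u).
rewrite !lebesgue_measure_itv/= !lte_fin ltr_pM2r ?invr_gt0// ltrD2r.
case: ifPn => xy; last by rewrite mule0.
by rewrite -!EFinB -EFinM; congr EFin; field; rewrite gt_eqF.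
Qed.

(** The substitution y = a + s u in the Lebesgue integral: if u is standard normal, then
    a + s u is normal with mean a and standard deviation s. *)
Lemma integral_affine_gaussian (a s : R) (g : measurableTypeR R -> \bar R) :
  (0 < s)%R -> measurable_fun setT g -> (forall x, 0 <= g x) ->
  \int[normal_prob 0 1]_u g (a + s * u)%R =
  \int[leb]_y (g y * (normal_pdf a s y)%:E).
Proof.
move=> s0 mg g0.
have mgp : measurable_fun setT (fun y => g y * (normal_pdf a s y)%:E).
  by apply: emeasurable_funM => //; exact: mpdf.
have gp0 y : 0 <= g y * (normal_pdf a s y)%:E.
  by rewrite mule_ge0// lee_fin normal_pdf_ge0.
rewrite (integral_normal_prob _ _
  (measurableT_comp mg (measurable_affine a s)))/=; last by move=> u; exact: g0.
rewrite [RHS](eq_measure_integral (affine_lebesgue a s0)); last first.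
  by move=> A mA _; exact: affine_lebesgueE.
rewrite ge0_integral_mscale// ge0_integral_pushforward//; last first.
  exact: measurable_affine.
rewrite preimage_setT.
rewrite -ge0_integralZl//; last 2 first.
- exact: (measurableT_comp mgp (measurable_affine a s)).
- by move=> u _; exact: gp0.
apply: eq_integral => u _ /=; rewrite muleCA; congr (_ * _).
rewrite -EFinM; congr EFin.
rewrite !normal_pdfE ?gt_eqF//= /normal_peak /normal_fun.
rewrite mulrA; congr (_ * _)%R.
  rewrite expr1n -!mulrnAr !mul1r sqrtrM ?sqr_ge0// sqrtr_sqr gtr0_norm// invfM.
  by rewrite mulVKf// gt_eqF.
by rewrite /affine; congr expR; field; rewrite gt_eqF.
Qed.

(** Completing the square: the integrand times the standard normal density is a constant
    times the normal density with mean b / (1 + c) and variance 1 / (1 + c). *)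
Lemma gaussian_integral_quadratic (c b : R) : (0 < 1 + c)%R ->
  \int[normal_prob 0 1]_y (expR (- (c / 2) * y ^+ 2 + b * y))%:E =
  ((Num.sqrt (1 + c))^-1 * expR (b ^+ 2 / (2 * (1 + c))))%:E.
Proof.
move=> c0; rewrite integral_normal_prob//; last first.
  apply/measurable_EFinP; apply: measurableT_comp => //.
  by apply: measurable_funD => //; exact: measurable_funM.
pose s := ((Num.sqrt (1 + c))^-1)%R.
have s0 : (0 < s)%R by rewrite invr_gt0 sqrtr_gt0.
have ss : (s ^+ 2 = (1 + c)^-1)%R by rewrite exprVn sqr_sqrtr// ltW.
transitivity (\int[leb]_y ((s * expR (b ^+ 2 / (2 * (1 + c))))%:E *
    (normal_pdf (b / (1 + c)) s y)%:E)).
  apply: eq_integral => y _; rewrite -!EFinM; congr EFin.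
  rewrite !normal_pdfE ?gt_eqF//= /normal_peak /normal_fun.
  rewrite expr1n -!mulrnAr !mul1r sqrtrM ?sqr_ge0// sqrtr_sqr gtr0_norm//.
  have -> : (s * (s *+ 2) = 2 / (1 + c))%R by rewrite -ss expr2 -mulr_natr; ring.
  set p := (Num.sqrt _)^-1%R; set E1 := expR _; set E2 := expR _.
  set E3 := expR _; set E4 := expR _.
  have e : (E1 * E2 = E3 * E4)%R.
    by rewrite /E1 /E2 /E3 /E4 -!expRD; congr expR; field; rewrite gt_eqF.
  rewrite invfM mulrCA e -/p !mulrA; congr (_ * _)%R.
  by rewrite [(s * _)%R]mulrC mulfK ?gt_eqF// mulrC.
rewrite ge0_integralZl//.
- by rewrite integral_normal_pdf mule1.
- exact: mpdf.
- by move=> y _; rewrite lee_fin normal_pdf_ge0.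
- by rewrite lee_fin mulr_ge0 ?expR_ge0// ltW.
Qed.

End integral_tools.

(** * The Cheeger inequality for the Gaussian measure on the line *)

Section cheeger.
Variable R : realType.
Local Notation leb := (@lebesgue_measure R).
Local Notation mu := (@normal_prob R 0 1).
Implicit Types (S : set (measurableTypeR R)) (r x y z : R).

(** Open, hence Borel, for every S; [enlarge S r] may fail to be Borel. *)
Definition open_enlarge S r : set (measurableTypeR R) :=
  [set z : R | exists2 s : R, S s & `|z - s| < r].

Lemma measurable_open_enlarge S r : measurable (open_enlarge S r).
Proof.
apply: open_measurable.
have -> : open_enlarge S r = \bigcup_(s in S) (ball (s : R^o) r : set R).
  apply/seteqP; split => z /= [s Ss zs]; exists s => //.
    by rewrite /ball/= distrC.
  by move: zs; rewrite /ball/= distrC.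
by apply: bigcup_open => s _; exact: ball_open.
Qed.

Lemma sub_open_enlarge S r : 0 < r -> S `<=` open_enlarge S r.
Proof. by move=> r0 x Sx; exists x => //; rewrite subrr normr0. Qed.

Lemma open_enlarge_sub S r : open_enlarge S r `<=` enlarge S r.
Proof.
move=> z [s Ss zs]; exists s => //; exists (z - s); last by rewrite addrC subrK.
by rewrite /= in_itv/= -ler_norml ltW.
Qed.

Definition between x y z := (x < z < y) || (y < z < x).

(** This is the geometric core of the one-dimensional isoperimetry: between a point x of S
    and a point y at distance at least r from S, the layer that the enlargement adds to S
    contains a whole interval of length r. If x < y, let t be the supremum of the points
    of S below y. It is at most y - r, there is no point of S between t and y, and every
    point of ]t, t + r[ is within r of a point of S close to t. *)
Lemma crossing_layer S r x y : 0 < r -> S x -> ~ open_enlarge S r y ->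
  exists t : R, forall z, t < z < t + r ->
    (open_enlarge S r `\` S) z /\ between x y z.
Proof.
move=> r0 Sx Uy.
have far s : S s -> r <= `|y - s|.
  by move=> Ss; rewrite leNgt; apply/negP => ys; apply: Uy; exists s.
have [xy|yx|xy] := ltgtP x y; last by case: Uy; rewrite -xy; exact: sub_open_enlarge.
- pose A := [set s : R | S s /\ s < y].
  have Ax : A x by [].
  have Ay s : A s -> s <= y - r.
    by move=> [/far + sy]; rewrite gtr0_norm ?subr_gt0// => ?; lra.
  have supA : has_sup A by split; [exists x|exists (y - r)].
  have Asup s : A s -> s <= sup A by move=> As; exact: sup_upper_bound.
  have supy : sup A <= y - r by apply: ge_sup => //; exists x.
  exists (sup A) => z /andP[tz zt].
  have zy : z < y by lra.
  split; last by rewrite /between zy (le_lt_trans (Asup _ Ax) tz).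
  split; last by move=> Sz; have := Asup z (conj Sz zy); rewrite leNgt tz.
  have [|s As sz] := @sup_adherent _ A (sup A + r - z) _ supA; first by lra.
  exists s; first by case: As.
  by have := Asup _ As; move=> ?; rewrite gtr0_norm; lra.
- pose A := [set s : R | S s /\ y < s].
  have Ax : A x by [].
  have Ay s : A s -> y + r <= s.
    by move=> [/far + sy]; rewrite ltr0_norm ?subr_lt0// => ?; lra.
  have infA : has_inf A by split; [exists x|exists (y + r)].
  have Ainf s : A s -> inf A <= s by move=> As; exact: (ge_inf infA.2).
  have infy : y + r <= inf A by apply: lb_le_inf => //; exists x.
  exists (inf A - r) => z /andP[tz zt].
  have zt' : z < inf A by lra.
  have zy : y < z by lra.
  split; last by rewrite /between zy (lt_le_trans zt' (Ainf _ Ax)) orbT.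
  split; last by move=> Sz; have := Ainf z (conj Sz zy); rewrite leNgt zt'.
  have [|s As sz] := @inf_adherent _ A (z - inf A + r) _ infA; first by lra.
  exists s; first by case: As.
  by have := Ainf _ As; move=> ?; rewrite ltr0_norm; lra.
Qed.

Local Open Scope ereal_scope.

(** One of the two half-lines lies on the far side of z from the origin. There
    exp (- y^2 / 2) <= exp (- z^2 / 2) exp (- (y - z)^2 / 2), which bounds its mass by the
    density at z up to a constant; the other factor is at most 1. *)
Lemma normal_prob_tail z :
  mu `]-oo, z[ * mu `]z, +oo[ <= (normal_peak 1 : R)^-1%:E * (normal_pdf 0 1 z)%:E.
Proof.
have p0 : (0 < normal_peak 1 :> R)%R by exact: normal_peak_gt0.
have tail (A : set (measurableTypeR R)) : measurable A ->
    (forall y, A y -> (0 <= z * (y - z))%R) ->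
    mu A <= (normal_peak 1 : R)^-1%:E * (normal_pdf 0 1 z)%:E.
  move=> mA Az.
  have c0 : (0 <= (normal_peak 1)^-1 * normal_pdf 0 1 z)%R.
    by rewrite mulr_ge0 ?normal_pdf_ge0// invr_ge0 ltW.
  have mp s : measurable_fun setT (fun y : measurableTypeR R => (normal_pdf s 1 y)%:E).
    by apply/measurable_EFinP; exact: measurable_normal_pdf.
  have p00 s (y : R) : 0 <= (normal_pdf s 1 y)%:E by rewrite lee_fin normal_pdf_ge0.
  rewrite -EFinM -[leRHS]mule1 -(@integral_normal_pdf R z 1) -ge0_integralZl//.
  rewrite [leLHS]integral_mkcond; apply: le_integral_nonmeasurable => y; rewrite patchE.
    by case: ifPn => // _.
  case: ifPn => [|_]; last by rewrite mule_ge0 ?lee_fin ?normal_pdf_ge0.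
  rewrite inE => /Az zy; rewrite -EFinM lee_fin !normal_pdfE ?oner_neq0//.
  rewrite /normal_fun mulKf ?gt_eqF// mulrCA ler_pM2l// -expRD ler_expR.
  rewrite !subr0 expr1n -mulr_natr mul1r !mulNr -opprD lerN2 -mulrDl.
  by rewrite ler_pM2r ?invr_gt0//; lra.
have [z0|z0] := leP 0%R z.
  apply: le_trans (tail `]z, +oo[%classic _ _) => //; last first.
    by move=> y /=; rewrite in_itv/= andbT => zy; rewrite mulr_ge0// subr_ge0 ltW.
  rewrite -[leRHS]mul1e; apply: lee_pmul => //; exact: probability_le1.
apply: le_trans (tail `]-oo, z[%classic _ _) => //; last first.
  by move=> y /=; rewrite in_itv/= => zy; rewrite mulr_le0// ?subr_le0 ltW.
rewrite -[leRHS]mule1; apply: lee_pmul => //; exact: probability_le1.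
Qed.

(** Integrate [crossing_layer] over x in S and y outside the enlargement: r is at most the
    Lebesgue measure of the layer points between x and y. After exchanging the integrals,
    each layer point z is weighted by the probability that it separates x from y, namely
    2 mu ]-oo, z[ mu ]z, +oo[. By [normal_prob_tail] this is at most a multiple of the density
    at z, which turns the Lebesgue measure of the layer into its Gaussian measure. *)
Lemma layer_bound S r : measurable S -> (0 < r)%R ->
  r%:E * (mu S * mu (~` open_enlarge S r)) <=
  (2 / normal_peak 1)%:E * mu (open_enlarge S r `\` S).
Proof.
move=> mS r0; set U := open_enlarge S r; set b := U `\` S.
have mU : measurable U by exact: measurable_open_enlarge.
have mb : measurable b by exact: measurableD.
pose f x y z : \bar R := (\1_b z)%:E * ((between x y z)%:R : R)%:E.
have f0 x y z : 0 <= f x y z by rewrite mule_ge0// lee_fin.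
have mi (C : set (measurableTypeR R)) : measurable C ->
    measurable_fun setT (fun x => (\1_C x : R)%:E).
  by move=> mC; apply/measurable_EFinP; exact: measurable_indic.
have mf : measurable_fun setT (fun q : (measurableTypeR R * measurableTypeR R) *
    measurableTypeR R => f q.1.1 q.1.2 q.2).
  apply: emeasurable_funM; first exact: measurableT_comp (mi _ mb) measurable_snd.
  have m11 : measurable_fun setT (fun q : (measurableTypeR R * measurableTypeR R) *
      measurableTypeR R => q.1.1 : R).
    exact: (measurableT_comp measurable_fst measurable_fst).
  have m12 : measurable_fun setT (fun q : (measurableTypeR R * measurableTypeR R) *
      measurableTypeR R => q.1.2 : R).
    exact: (measurableT_comp measurable_snd measurable_fst).
  have m2 : measurable_fun setT (fun q : (measurableTypeR R * measurableTypeR R) *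
      measurableTypeR R => q.2 : R).
    exact: measurable_snd.
  apply/measurable_EFinP; apply: measurable_natr_bool.
  by apply: measurable_or; apply: measurable_and; exact: measurable_fun_ltr.
have -> : r%:E * (mu S * mu (~` U)) =
    \int[mu]_x \int[mu]_y (r%:E * ((\1_S x)%:E * (\1_(~` U) y)%:E)).
  rewrite -(integral2_indic mu mu)//; last exact: measurableC.
  rewrite -ge0_integralZlT ?lee_fin 1?ltW//.
  - apply: eq_integral => x _; rewrite -ge0_integralZlT ?lee_fin 1?ltW//.
    by apply: measurable_funeM; apply: mi; exact: measurableC.
  - apply: (measurable_integralr mu (f := fun x y => (\1_S x)%:E * (\1_(~` U) y)%:E)).
      apply: emeasurable_funM.
        exact: measurableT_comp (mi _ mS) measurable_fst.
      by apply: measurableT_comp (mi _ _) measurable_snd; exact: measurableC.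
    by move=> x y; rewrite mule_ge0// lee_fin.
  - by move=> x; apply: integral_ge0 => y _; rewrite mule_ge0// lee_fin.
apply: (@le_trans _ _ (\int[mu]_x \int[mu]_y \int[leb]_z f x y z)).
  apply: le_integral_nonmeasurable => x.
    by apply: integral_ge0 => y _; rewrite !mule_ge0// lee_fin// ltW.
  apply: le_integral_nonmeasurable => y.
    by rewrite !mule_ge0// lee_fin// ltW.
  rewrite !indicE; have [|_] := boolP (x \in S); last first.
    by rewrite mul0e mule0; apply: integral_ge0.
  have [|_] := boolP (y \in _); last first.
    by move=> _; rewrite mule0 mule0; apply: integral_ge0.
  rewrite !inE => Uy Sx; rewrite !mule1.
  have [t tE] := crossing_layer r0 Sx Uy.
  apply: (@le_trans _ _ (\int[leb]_z (\1_(`]t, (t + r)%R[%classic : set R) z)%:E)).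
    rewrite integral_indicT; last exact: measurable_itv.
    have /= -> := lebesgue_measure_itv `]t, (t + r)%R[%R.
    by rewrite lte_fin ltrDl r0 -EFinB lee_fin addrAC subrr add0r.
  apply: le_integral_nonmeasurable => z; first by rewrite lee_fin.
  rewrite /f indicE; have [|_] := boolP (z \in _); last exact: f0.
  rewrite inE/= in_itv/= => /tE[bz xyz].
  by rewrite xyz mule1 indicE mem_set.
rewrite (tonelli3 mu mu leb mf f0).
have -> : mu b = \int[leb]_z ((\1_b z)%:E * (normal_pdf 0 1 z)%:E).
  by rewrite -integral_normal_prob_indic// integral_indicT.
rewrite -ge0_integralZlT; first last.
- by rewrite lee_fin divr_ge0// normal_peak_ge0.
- by move=> z; rewrite mule_ge0// lee_fin// normal_pdf_ge0.
- apply: emeasurable_funM; first exact: mi.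
  by apply/measurable_EFinP; exact: measurable_normal_pdf.
apply: le_integral_nonmeasurable => z.
  by apply: integral_ge0 => x _; apply: integral_ge0.
pose A := `]-oo, z[%classic : set (measurableTypeR R).
pose B := `]z, +oo[%classic : set (measurableTypeR R).
have mA : measurable A by exact: measurable_itv.
have mB : measurable B by exact: measurable_itv.
rewrite /f indicE; have [zb|zb] := boolP (z \in b); last first.
  rewrite mul0e mule0 integral0_eq// => x _; rewrite integral0_eq// => y _.
  by rewrite mul0e.
rewrite mul1e.
apply: (@le_trans _ _ (\int[mu]_x \int[mu]_y
    ((\1_A x)%:E * (\1_B y)%:E + (\1_B x)%:E * (\1_A y)%:E))).
  apply: le_integral_nonmeasurable => x; first exact: integral_ge0.
  apply: le_integral_nonmeasurable => y; first by rewrite mule_ge0 ?lee_fin.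
  rewrite mul1e -!EFinM -EFinD lee_fin !indicE -!natrM -natrD ler_nat.
  rewrite !mulnb /between.
  have inA w : (w \in A) = (w < z)%R by rewrite /A mem_setE in_itv.
  have inB w : (w \in B) = (z < w)%R by rewrite /B mem_setE in_itv/= andbT.
  rewrite !inA !inB.
  by rewrite [(y < z)%R && _]andbC; do 2 case: (_ && _).
have mprod (C D : set (measurableTypeR R)) : measurable C -> measurable D ->
    measurable_fun setT (fun p : measurableTypeR R * measurableTypeR R =>
      (\1_C p.1)%:E * (\1_D p.2 : R)%:E).
  move=> mC mD; apply: emeasurable_funM.
    exact: measurableT_comp (mi _ mC) measurable_fst.
  exact: measurableT_comp (mi _ mD) measurable_snd.
under eq_integral => x _.
  rewrite ge0_integralDT; first last.
  - by move=> y; rewrite mule_ge0// lee_fin.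
  - by apply: measurable_funeM; exact: mi.
  - by move=> y; rewrite mule_ge0// lee_fin.
  - by apply: measurable_funeM; exact: mi.
  over.
rewrite ge0_integralDT; first last.
- by move=> x; apply: integral_ge0 => y _; rewrite mule_ge0// lee_fin.
- apply: (measurable_integralr mu (mprod _ _ mB mA)) => x y.
  by rewrite mule_ge0// lee_fin.
- by move=> x; apply: integral_ge0 => y _; rewrite mule_ge0// lee_fin.
- apply: (measurable_integralr mu (mprod _ _ mA mB)) => x y.
  by rewrite mule_ge0// lee_fin.
rewrite !integral2_indic// [X in _ + X]muleC -mule2n -mule_natl EFinM -muleA.
by rewrite lee_wpmul2l ?lee_fin//; exact: normal_prob_tail.
Qed.

(** [normal_prob] is given on every set by the integral of a density, hence is monotone on
    all sets, such as [enlarge S r]. *)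
Lemma le_normal_prob_sub (A B : set (measurableTypeR R)) : A `<=` B -> mu A <= mu B.
Proof.
move=> AB; change (\int[leb]_(x in A) (normal_pdf 0 1 x)%:E <=
  \int[leb]_(x in B) (normal_pdf 0 1 x)%:E).
rewrite [leLHS]integral_mkcond [leRHS]integral_mkcond.
have p0 (x : R) : 0 <= (normal_pdf 0 1 x)%:E by rewrite lee_fin normal_pdf_ge0.
apply: le_integral_nonmeasurable => x; rewrite !patchE; first by case: ifPn.
case: ifPn => [|_]; last by case: ifPn.
by rewrite inE => /AB xB; rewrite mem_set.
Qed.

Definition cheeger_cst : R := (2 / normal_peak 1 + 1)%R.

Lemma cheeger_cst_ge1 : (1 <= cheeger_cst)%R.
Proof. by rewrite /cheeger_cst lerDr divr_ge0// normal_peak_ge0. Qed.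

(** Writing U for the open enlargement, mu (~` S) = mu (~` U) + mu (U `\` S). [layer_bound]
    controls the first term; since r <= 1, the second one accounts for the summand 1 of
    [cheeger_cst]. *)
Lemma cheeger_enlarge S r : measurable S -> (0 < r <= 1)%R ->
  mu S * mu (~` S) <=
  cheeger_cst%:E * ((mu (enlarge S r) - mu S) / r%:E).
Proof.
move=> mS /andP[r0 r1]; set U := open_enlarge S r.
have mU : measurable U by exact: measurable_open_enlarge.
have SU : S `<=` U by exact: sub_open_enlarge.
have mUS : measurable (U `\` S) by exact: measurableD.
have mUC : measurable (~` U) by exact: measurableC.
have mSC : measurable (~` S) by exact: measurableC.
have lay := layer_bound mS r0; rewrite -/U in lay.
have fin A : measurable A -> mu A \is a fin_num by move=> ?; exact: fin_num_measure.
have US : mu U = mu S + mu (U `\` S).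
  rewrite -measureU//; last by rewrite setDE setICA setICr setI0.
  congr mu; apply/seteqP; split => x /=; last by move=> [/SU//|[]].
  by move=> Ux; have [|] := pselect (S x); [left|right].
have C : mu (~` S) = mu (~` U) + mu (U `\` S).
  rewrite -measureU//; last by rewrite setDE setIA setICl set0I.
  congr mu; apply/seteqP; split => x /=.
    by move=> Sx; have [|] := pselect (U x); [right|left].
  by move=> [Ux /SU//|[]].
have b_le : mu (U `\` S) / r%:E <= (mu (enlarge S r) - mu S) / r%:E.
  rewrite inver gt_eqF//; apply: lee_wpmul2r; first by rewrite lee_fin invr_ge0 ltW.
  rewrite leeBrDl; last exact: fin.
  by rewrite -US; apply: le_normal_prob_sub; exact: open_enlarge_sub.
have C0 : (0 <= 2 / normal_peak 1 :> R)%R by rewrite divr_ge0// normal_peak_ge0.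
apply: (@le_trans _ _ ((2 / normal_peak 1 + 1)%:E * (mu (U `\` S) / r%:E))); last first.
  by apply: lee_wpmul2l => //; rewrite lee_fin addr_ge0.
rewrite C inver gt_eqF//.
have p1 : mu S <= 1 by exact: probability_le1.
have b0 : 0 <= mu (U `\` S) by exact: measure_ge0.
have p0 : 0 <= mu S by exact: measure_ge0.
move: lay p1 b0 p0.
rewrite -(fineK (fin _ mS)) -(fineK (fin _ mUC)) -(fineK (fin _ mUS)).
set p := fine _; set u := fine _; set b := fine _.
rewrite -!EFinD -!EFinM !lee_fin => lay p1 b0 p0.
have pbr : (p * (b * r) <= 1 * (b * 1))%R.
  by apply: ler_pM => //; [rewrite mulr_ge0// ltW|exact: ler_wpM2l].
rewrite mulr1 in pbr; rewrite mulrA ler_pdivlMr// mulrDl.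
have -> : (p * (u + b) * r = r * (p * u) + p * (b * r))%R by ring.
exact: lerD.
Qed.

(** The bound of [cheeger_enlarge] is uniform in r <= 1, so it passes to the lower limit. *)
Lemma gaussian_cheeger S : measurable S ->
  mu S * mu (~` S) <= cheeger_cst%:E * minkowski_content S.
Proof.
move=> mS; have c0 : (0 < cheeger_cst)%R by exact: lt_le_trans cheeger_cst_ge1.
rewrite -lee_pdivrMl// /minkowski_content limf_einfE.
apply: ereal_sup_ge; exists (ereal_inf ((fun r : R =>
    (mu (enlarge S r) - mu S) / r%:E) @` [set r : R | 0 < r <= 1]%R)).
  exists [set r : R | 0 < r <= 1]%R => //.
  near=> r => /=; apply/andP; split; first by near: r; exact: nbhs_right_gt.
  by near: r; apply: nbhs_right_le.
apply: le_ereal_inf_tmp => _ [r /= r01 <-]; rewrite lee_pdivrMl//.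
exact: cheeger_enlarge.
Unshelve. all: by end_near. Qed.

End cheeger.

(** * The Mehler kernel *)

Section mehler_kernel.
Variable R : realType.
Local Notation mu := (@normal_prob R 0 1).
Implicit Types r s x y z : R.

(** The density, with respect to the standard normal law of y, of r x + sqrt (1 - r^2) u
    where u is standard normal; see [integral_noisy]. *)
Definition mehler r x y : R :=
  (Num.sqrt (1 - r ^+ 2))^-1 *
  expR (- (r ^+ 2 * x ^+ 2 - 2 * r * x * y + r ^+ 2 * y ^+ 2) / (2 * (1 - r ^+ 2))).

Lemma mehler_ge0 r x y : 0 <= mehler r x y.
Proof. by rewrite mulr_ge0 ?expR_ge0// invr_ge0. Qed.

Lemma mehlerC r x y : mehler r x y = mehler r y x.
Proof. by rewrite /mehler; congr (_ * expR _); ring. Qed.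

Lemma measurable_mehler r d (T : measurableType d) (f g : T -> R) :
  measurable_fun setT f -> measurable_fun setT g ->
  measurable_fun setT (fun t => mehler r (f t) (g t)).
Proof.
move=> mf mg; apply: measurable_funM => //; apply: measurableT_comp => //.
apply: measurable_funM => //; apply: measurable_funN.
apply: measurable_funD; last by apply: measurable_funM => //; exact: measurable_funX.
apply: measurable_funB; first by apply: measurable_funM => //; exact: measurable_funX.
by apply: measurable_funM => //; apply: measurable_funM.
Qed.

Lemma gaussian_integral_exp (k c b d : R) : 0 <= k -> 0 < 1 + c ->
  (\int[mu]_y (k * expR (- (c / 2) * y ^+ 2 + b * y + d))%:E =
  (k * (Num.sqrt (1 + c))^-1 * expR (b ^+ 2 / (2 * (1 + c)) + d))%:E)%E.
Proof.
move=> k0 c0.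
rewrite (eq_integral (fun y : measurableTypeR R => (k * expR d)%:E *
    (expR (- (c / 2) * y ^+ 2 + b * y))%:E)%E); last first.
  by move=> y _; rewrite -EFinM; congr EFin; rewrite expRD; ring.
rewrite ge0_integralZlT.
- rewrite gaussian_integral_quadratic// -EFinM; congr EFin.
  by rewrite [in RHS]expRD; ring.
- apply/measurable_EFinP; apply: measurableT_comp => //.
  by apply: measurable_funD; apply: measurable_funM => //; exact: measurable_funX.
- by move=> y; rewrite lee_fin expR_ge0.
- by rewrite lee_fin mulr_ge0 ?expR_ge0.
Qed.

Lemma sub1sqr_gt0 r : 0 <= r < 1 -> 0 < 1 - r ^+ 2.
Proof. by move=> /andP[r0 r1]; rewrite subr_gt0 expr_lt1. Qed.

Lemma integral_mehler r x : 0 <= r < 1 -> (\int[mu]_y (mehler r x y)%:E = 1)%E.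
Proof.
move=> /sub1sqr_gt0; set t := 1 - r ^+ 2 => t0.
have t1 : t != 0 by rewrite gt_eqF.
have rt : r ^+ 2 = 1 - t by rewrite /t; ring.
rewrite (eq_integral (fun y : measurableTypeR R =>
    ((Num.sqrt t)^-1 * expR (- ((r ^+ 2 / t) / 2) * y ^+ 2
    + (r * x / t) * y + - (r ^+ 2 * x ^+ 2 / (2 * t))))%:E)); last first.
  by move=> y _; rewrite /mehler -/t; congr (_ * expR _)%:E; field.
have c1 : 1 + r ^+ 2 / t = t^-1 by rewrite rt; field.
rewrite gaussian_integral_exp ?c1 ?invr_gt0 ?invr_ge0//.
rewrite sqrtrV ?ltW// invrK mulVf ?gt_eqF ?sqrtr_gt0// mul1r.
rewrite [X in expR X](_ : _ = 0) ?expR0//.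
by field.
Qed.

(** Two successive noises of correlation r make one of correlation r^2. The integrand is
    the exponential of a quadratic polynomial in x, so both sides can be computed. *)
Lemma mehler_semigroup r y z : 0 <= r < 1 ->
  (\int[mu]_x (mehler r x y * mehler r x z)%:E = (mehler (r ^+ 2) y z)%:E)%E.
Proof.
move=> r01; have t0 := sub1sqr_gt0 r01; move: t0; set t := 1 - r ^+ 2 => t0.
have t1 : t != 0 by rewrite gt_eqF.
have rt : r ^+ 2 = 1 - t by rewrite /t; ring.
have u0 : 0 < 1 + r ^+ 2 by rewrite ltr_pwDl// sqr_ge0.
have u1 : 1 + r ^+ 2 != 0 by rewrite gt_eqF.
have u2 : 2 - t != 0 by move: u1; rewrite rt (_ : 1 + (1 - t) = 2 - t)//; ring.
rewrite (eq_integral (fun x : measurableTypeR R =>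
    (t^-1 * expR (- ((2 * r ^+ 2 / t) / 2) * x ^+ 2
    + (r * (y + z) / t) * x + - (r ^+ 2 * (y ^+ 2 + z ^+ 2) / (2 * t))))%:E)); last first.
  move=> x _; rewrite /mehler -/t mulrACA -invfM -expr2 sqr_sqrtr ?ltW// -expRD.
  by congr (_ * expR _)%:E; field.
have c1 : 1 + 2 * r ^+ 2 / t = (1 + r ^+ 2) / t by rewrite rt; field.
rewrite gaussian_integral_exp ?c1 ?divr_gt0 ?invr_ge0 1?ltW//.
have e : 1 - (r ^+ 2) ^+ 2 = (1 + r ^+ 2) * t by rewrite /t; ring.
rewrite /mehler e; congr (_ * expR _)%:E; last by rewrite /t; field; rewrite -/t ?t1 ?u1.
rewrite !sqrtrM ?(ltW u0)// sqrtrV ?ltW//.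
set p := Num.sqrt t.
have -> : t^-1 = (p * p)^-1 by rewrite -expr2 sqr_sqrtr// ltW.
by field; rewrite !gt_eqF ?sqrtr_gt0.
Qed.

Lemma integral_noisy r rho x (g : measurableTypeR R -> \bar R) :
  0 < rho -> 0 <= r -> r ^+ 2 + rho ^+ 2 = 1 ->
  measurable_fun setT g -> (forall x, (0 <= g x)%E) ->
  (\int[mu]_u g (r * x + rho * u)%R = \int[mu]_y (g y * (mehler r x y)%:E))%E.
Proof.
move=> rho0 r0 rr mg g0; rewrite integral_affine_gaussian//.
have mm : measurable_fun setT (fun y : measurableTypeR R => (mehler r x y)%:E).
  by apply/measurable_EFinP; exact: measurable_mehler.
rewrite integral_normal_prob; last first.
- by move=> y; rewrite mule_ge0// lee_fin mehler_ge0.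
- exact: emeasurable_funM.
apply: eq_integral => y _; rewrite -muleA; congr (_ * _)%E.
rewrite -EFinM; congr EFin.
have t0 : 1 - r ^+ 2 = rho ^+ 2 by rewrite -rr; ring.
rewrite !normal_pdfE ?gt_eqF//= /normal_peak /normal_fun /mehler t0.
have n0 : rho != 0 by rewrite gt_eqF.
rewrite expr1n -!mulrnAr !mul1r sqrtrM ?sqr_ge0// sqrtr_sqr gtr0_norm// invfM.
rewrite mulrACA -expRD; congr (_ * expR _).
have -> : rho * (rho *+ 2) = 2 * rho ^+ 2 by rewrite -mulr_natr; ring.
rewrite -t0 subr0; field.
by rewrite t0 expf_neq0.
Qed.

(** For s = r^2, the diagonal value [mehler s x x] is the squared L2 norm of [mehler r x],
    by [mehler_semigroup]. Its square is a multiple of exp (2 s x^2 / (1 + s)), integrable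
    for s < 1/3. The value 4/3 is what [mehler_two_four] can afford, and s <= 1/16 ensures
    it with room to spare. *)
Lemma integral_mehler_diag s : 0 <= s <= 16^-1 ->
  (\int[mu]_x ((mehler s x x) ^+ 2)%:E <= (4 / 3)%:E)%E.
Proof.
move=> /andP[s0 s16].
have t0 : 0 < 1 - s ^+ 2 by nra.
have p0 : 0 < 1 + s by lra.
have q0 : 0 < 1 - s by lra.
rewrite (eq_integral (fun x : measurableTypeR R => ((1 - s ^+ 2)^-1 *
    expR (- ((- 4 * s / (1 + s)) / 2) * x ^+ 2 + 0 * x + 0))%:E)); last first.
  move=> x _; rewrite /mehler exprMn exprVn sqr_sqrtr ?ltW// -expRM_natl.
  have -> : 1 - s ^+ 2 = (1 - s) * (1 + s) by ring.
  by congr (_ * expR _)%:E; field; rewrite !gt_eqF.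
have c1 : 1 + - 4 * s / (1 + s) = (1 - 3 * s) / (1 + s) by field; rewrite gt_eqF.
have w0 : 0 < 1 - 3 * s by lra.
rewrite gaussian_integral_exp ?c1 ?divr_gt0//; last by rewrite invr_ge0 ltW.
rewrite expr0n/= mul0r addr0 expR0 mulr1 lee_fin.
have h1 : (1 - s ^+ 2)^-1 <= 10 / 9.
  by rewrite -[leRHS]invrK lef_pV2 ?posrE//; nra.
have h2 : (Num.sqrt ((1 - 3 * s) / (1 + s)))^-1 <= 6 / 5.
  rewrite -[leRHS]invrK lef_pV2 ?posrE ?sqrtr_gt0 ?divr_gt0//.
  rewrite -[leLHS]ger0_norm// -sqrtr_sqr ler_wsqrtr// ler_pdivlMr//; nra.
apply: (@le_trans _ _ (10 / 9 * (6 / 5))); last by lra.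
by apply: ler_pM => //; rewrite invr_ge0 ?sqrtr_ge0// ltW.
Qed.

End mehler_kernel.

(** * Noise on Gaussian space *)

Section gaussian_kernel.
Variable R : realType.
Local Notation mu := (@normal_prob R 0 1).
Implicit Types r : R.

Lemma measurable_euclid0 d (T : measurableType d) (f : euclid R 0 -> T) :
  measurable_fun setT f.
Proof.
move=> _ Y mY; have [fY|fY] := pselect (Y (f [tuple])).
  rewrite (_ : _ `&` _ = setT)//; apply/seteqP; split => // x _.
  by split => //; rewrite /preimage/= (tuple0 x).
rewrite (_ : _ `&` _ = set0)//; apply/seteqP; split => // x [_].
by rewrite /preimage/= (tuple0 x).
Qed.

Lemma integral_gaussian0 (f : euclid R 0 -> \bar R) :
  (\int[gaussian R 0]_x f x = f [tuple])%E.
Proof.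
by rewrite integral_dirac//; [rewrite diracT mul1e|exact: measurable_euclid0].
Qed.

Lemma integral_gaussianS n (f : euclid R n.+1 -> \bar R) :
  measurable_fun setT f -> (forall x, (0 <= f x)%E) ->
  (\int[gaussian R n.+1]_x f x =
   \int[mu]_x \int[gaussian R n]_X f [tuple of x :: X])%E.
Proof.
move=> mf f0; rewrite ge0_integral_distribution//.
have mfc : measurable_fun setT (f \o @cons_coord R n).
  by apply: measurableT_comp; [exact: mf|exact: measurable_cons_coord].
exact (@fubini_tonelli1 _ _ _ _ _ mu (gaussian R n) _ mfc (fun p => f0 _)).
Qed.

Definition kernel r n (x y : euclid R n) : R :=
  \prod_(i < n) mehler r (tnth x i) (tnth y i).

Lemma kernel_cons r n x y (X Y : euclid R n) :
  kernel r [tuple of x :: X] [tuple of y :: Y] = mehler r x y * kernel r X Y.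
Proof.
rewrite /kernel big_ord_recl; congr (_ * _).
by apply: eq_bigr => i _; rewrite !tnthS.
Qed.

Lemma kernel_nil r (X Y : euclid R 0) : kernel r X Y = 1.
Proof. by rewrite /kernel big_ord0. Qed.

Lemma kernel_ge0 r n (X Y : euclid R n) : 0 <= kernel r X Y.
Proof. by apply: prodr_ge0 => i _; exact: mehler_ge0. Qed.

Lemma kernelC r n (X Y : euclid R n) : kernel r X Y = kernel r Y X.
Proof. by apply: eq_bigr => i _; exact: mehlerC. Qed.

Lemma measurable_kernel r n d (T : measurableType d) (f g : T -> euclid R n) :
  measurable_fun setT f -> measurable_fun setT g ->
  measurable_fun setT (fun t => kernel r (f t) (g t)).
Proof.
move=> mf mg; apply: measurable_prod => i _.
have mt := @measurable_tnth _ (measurableTypeR R) n i.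
by apply: measurable_mehler; [exact: measurableT_comp mt mf|exact: measurableT_comp mt mg].
Qed.

Lemma measurable_consl n x : measurable_fun setT
  (fun X : euclid R n => [tuple of x :: X] : euclid R n.+1).
Proof. exact: measurable_cons. Qed.

Lemma integral_kernel r n (X : euclid R n) : 0 <= r < 1 ->
  (\int[gaussian R n]_Y (kernel r X Y)%:E = 1)%E.
Proof.
move=> r01; have mk m (Z : euclid R m) :
    measurable_fun setT (fun Y : euclid R m => (kernel r Z Y)%:E).
  by apply/measurable_EFinP; exact: measurable_kernel.
elim: n X => [|n IHn] X.
  by rewrite integral_gaussian0// kernel_nil.
case/tupleP: X => x X; rewrite integral_gaussianS//; last first.
  by move=> Y; rewrite lee_fin kernel_ge0.
rewrite -(integral_mehler x r01); apply: eq_integral => y _.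
under eq_integral do rewrite kernel_cons EFinM.
rewrite ge0_integralZlT ?IHn ?mule1 ?lee_fin ?mehler_ge0//; first exact: mk.
by move=> Y; rewrite lee_fin kernel_ge0.
Qed.

(** Coordinatewise from [mehler_semigroup], both kernels and measures being products. *)
Lemma kernel_semigroup r n (Y Z : euclid R n) : 0 <= r < 1 ->
  (\int[gaussian R n]_X (kernel r X Y * kernel r X Z)%:E =
   (kernel (r ^+ 2) Y Z)%:E)%E.
Proof.
move=> r01; have mk m (Y' Z' : euclid R m) :
    measurable_fun setT (fun X : euclid R m => (kernel r X Y' * kernel r X Z')%:E).
  by apply/measurable_EFinP; apply: measurable_funM; exact: measurable_kernel.
have k0 m (X' Y' Z' : euclid R m) : (0 <= (kernel r X' Y' * kernel r X' Z')%:E)%E.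
  by rewrite lee_fin mulr_ge0 ?kernel_ge0.
elim: n Y Z => [|n IHn] Y Z.
  by rewrite integral_gaussian0// !kernel_nil mulr1.
case/tupleP: Y => y Y; case/tupleP: Z => z Z.
rewrite integral_gaussianS// kernel_cons EFinM -(mehler_semigroup y z r01) -IHn.
rewrite muleC -ge0_integralZlT//; first last.
- exact: integral_ge0.
- by move=> x; rewrite lee_fin mulr_ge0// mehler_ge0.
- by apply/measurable_EFinP; apply: measurable_funM; exact: measurable_mehler.
apply: eq_integral => x _; rewrite muleC -ge0_integralZlT//; last 2 first.
- exact: mk.
- by rewrite lee_fin mulr_ge0// mehler_ge0.
by apply: eq_integral => X _; rewrite !kernel_cons -EFinM mulrACA.
Qed.

Lemma noisy_cons rho n x u (X U : euclid R n) :
  noisy rho [tuple of x :: X] [tuple of u :: U] =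
  [tuple of (Num.sqrt (1 - rho ^+ 2) * x + rho * u) :: noisy rho X U].
Proof.
apply/eq_from_tnth => i; rewrite tnth_mktuple.
by case: (unliftP ord0 i) => [j|] ->; rewrite ?tnth0 ?tnthS ?tnth_mktuple.
Qed.

Lemma measurable_noisy rho n d (T : measurableType d) (f g : T -> euclid R n) :
  measurable_fun setT f -> measurable_fun setT g ->
  measurable_fun setT (fun t => noisy rho (f t) (g t)).
Proof.
move=> mf mg; apply/measurable_fun_tnthP => i.
rewrite (_ : _ \o _ = fun t => Num.sqrt (1 - rho ^+ 2) * tnth (f t) i + rho * tnth (g t) i).
  have mt := @measurable_tnth _ (measurableTypeR R) n i.
  apply: measurable_funD; apply: measurable_funM => //.
    exact: measurableT_comp mt mf.
  exact: measurableT_comp mt mg.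
by apply/funext => t /=; rewrite tnth_mktuple.
Qed.

(** The kernel is the conditional density of W^rho given W, where the correlation r is
    sqrt (1 - rho^2). The first coordinate is treated by [integral_noisy] after the others
    have been integrated out. *)
Lemma integral_noisy_kernel rho n (X : euclid R n) (g : euclid R n -> \bar R) :
  0 < rho < 1 -> measurable_fun setT g -> (forall Y, (0 <= g Y)%E) ->
  (\int[gaussian R n]_U g (noisy rho X U) =
   \int[gaussian R n]_Y (g Y * (kernel (Num.sqrt (1 - rho ^+ 2)) X Y)%:E))%E.
Proof.
move=> /andP[rho0 rho1]; set r := Num.sqrt _.
have r0 : 0 <= r by exact: sqrtr_ge0.
have rr : r ^+ 2 + rho ^+ 2 = 1.
  by rewrite sqr_sqrtr ?subrK// subr_ge0 expr_le1// ltW.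
have mk m (Z : euclid R m) d (T : measurableType d) (h : T -> euclid R m) :
    measurable_fun setT h ->
    measurable_fun setT (fun t => (kernel r Z (h t))%:E).
  by move=> mh; apply/measurable_EFinP; exact: measurable_kernel.
elim: n X g => [|n IHn] X g mg g0.
  by rewrite !integral_gaussian0 kernel_nil mule1 [noisy _ _ _]tuple0.
have mnX : measurable_fun setT (noisy rho X) by exact: measurable_noisy.
have mgn : measurable_fun setT (fun U => g (noisy rho X U)).
  exact: measurableT_comp mg mnX.
have mgk : measurable_fun setT (fun Y => (g Y * (kernel r X Y)%:E)%E).
  by apply: emeasurable_funM => //; exact: mk.
have gk0 Y : (0 <= g Y * (kernel r X Y)%:E)%E.
  by rewrite mule_ge0// lee_fin kernel_ge0.
rewrite (integral_gaussianS mgn (fun U => g0 _)) (integral_gaussianS mgk gk0).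
move: mgn mgk gk0 => _ _ _.
case/tupleP: X mnX => x X mnX.
pose G y := (\int[gaussian R n]_Y (g [tuple of y :: Y] * (kernel r X Y)%:E))%E.
have mG0 : measurable_fun setT (fun p : measurableTypeR R * euclid R n =>
    g [tuple of p.1 :: p.2] * (kernel r X p.2)%:E)%E.
  apply: emeasurable_funM; last exact: mk.
  exact: measurableT_comp mg (measurable_cons measurable_fst measurable_snd).
have mG : measurable_fun setT G.
  apply: (measurable_integralr _ mG0) => y Y.
  by rewrite mule_ge0// lee_fin kernel_ge0.
have G0 y : (0 <= G y)%E.
  by apply: integral_ge0 => Y _; rewrite mule_ge0// lee_fin kernel_ge0.
transitivity (\int[mu]_u G (r * x + rho * u)%R)%E.
  apply: eq_integral => u _; rewrite /G -IHn//.
  - by apply: eq_integral => U _; rewrite noisy_cons.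
  - exact: measurableT_comp mg (measurable_consl _).
rewrite (integral_noisy x rho0 r0 rr mG G0); apply: eq_integral => y _.
rewrite /G muleC -ge0_integralZlT//.
- by apply: eq_integral => Y _; rewrite kernel_cons EFinM muleCA.
- apply: emeasurable_funM; last exact: mk.
  exact: measurableT_comp mg (measurable_consl _).
- by move=> Y; rewrite mule_ge0// lee_fin kernel_ge0.
- by rewrite lee_fin mehler_ge0.
Qed.

End gaussian_kernel.

(** * Hypercontractivity *)

Section hypercontractivity.
Variable R : realType.
Local Notation mu := (@normal_prob R 0 1).
Implicit Types r : R.
Local Open Scope ereal_scope.

(** The Cauchy-Schwarz inequality for u - a and v - b, expressed by the raw moments. *)
Lemma covariance_sqr_le d (T : measurableType d) (P : probability T R)
    (u v : T -> R) (a b al be c : R) :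
  measurable_fun setT u -> measurable_fun setT v ->
  (forall t, 0 <= u t)%R -> (forall t, 0 <= v t)%R ->
  \int[P]_t (u t)%:E = a%:E -> \int[P]_t (v t)%:E = b%:E ->
  \int[P]_t (u t ^+ 2)%:E = al%:E -> \int[P]_t (v t ^+ 2)%:E = be%:E ->
  \int[P]_t (u t * v t)%:E = c%:E ->
  [/\ (0 <= al - a ^+ 2)%R, (0 <= be - b ^+ 2)%R &
  ((c - a * b) ^+ 2 <= (al - a ^+ 2) * (be - b ^+ 2))%R].
Proof.
move=> mu_ mv u0 v0 ua vb ual vbe uvc.
have L2 (w : T -> R) x : measurable_fun setT w -> (forall t, 0 <= w t)%R ->
    \int[P]_t (w t ^+ 2)%:E = x%:E -> w \in Lfun P 2%:E.
  move=> mw w0 wx; rewrite inE; apply/andP; split; rewrite inE//=.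
  rewrite /finite_norm unlock.
  under eq_integral => t _ do rewrite /= ger0_norm// powR_mulrn//.
  by rewrite wx poweR_EFin ltry.
have uL2 := L2 _ _ mu_ u0 ual; have vL2 := L2 _ _ mv v0 vbe.
have Pfin : P setT \is a fin_num := fin_num_measure P _ measurableT.
have uL1 := Lfun_subset12 Pfin uL2; have vL1 := Lfun_subset12 Pfin vL2.
have uvL1 : (u * v)%R \in Lfun P 1 := Lfun2_mul_Lfun1 uL2 vL2.
have Eu : 'E_P[u] = a%:E by rewrite unlock.
have Ev : 'E_P[v] = b%:E by rewrite unlock.
have cE : covariance P u v = (c - a * b)%:E.
  by rewrite covarianceE// Eu Ev EFinB EFinM; congr (_ - _); rewrite unlock.
have VuE : 'V_P[u] = (al - a ^+ 2)%:E.
  by rewrite varianceE// Eu EFinB -EFin_expe; congr (_ - _); rewrite unlock.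
have VvE : 'V_P[v] = (be - b ^+ 2)%:E.
  by rewrite varianceE// Ev EFinB -EFin_expe; congr (_ - _); rewrite unlock.
have A0 : (0 <= al - a ^+ 2)%R by rewrite -lee_fin -VuE variance_ge0.
have B0 : (0 <= be - b ^+ 2)%R by rewrite -lee_fin -VvE variance_ge0.
split => //.
have := covariance_le uL2 vL2; rewrite cE VuE VvE /= -EFinM lee_fin => le1.
have mvL2 : (\- v)%R \in Lfun P 2%:E.
  rewrite (_ : (\- v)%R = (-1 \o* v)%R); last first.
    by apply/funext => t /=; rewrite mulrN1.
  by apply: Lfun_scale => //; rewrite ler1n.
have := covariance_le uL2 mvL2.
rewrite varianceN// covarianceNr// cE VuE VvE /= -EFinM lee_fin => le2.
rewrite -real_normK ?num_real// -[leRHS]sqr_sqrtr ?mulr_ge0//.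
rewrite ler_sqr ?nnegrE ?sqrtr_ge0// sqrtrM//.
by rewrite ler_norml le1 andbT lerNl.
Qed.

(** Put t = h - m. Expanding (m + t)^4 and bounding 4 m t^3 by 2 m^2 t^2 + 2 t^4 leaves
    4 m^3 h - 3 m^4 + 8 m^2 t^2 + 3 t^4. The even powers of t are then bounded through N A and
    absorbed into (N + 1)^2 - 1 = N^2 + 2 N. The right-hand side involves only h and
    (N + 1)^2, whose means are available in [mehler_two_four]. *)
Lemma fourth_moment_bound (h m N A : R) : (0 <= m -> 0 <= N -> 0 <= A ->
  (h - m) ^+ 2 <= N * A ->
  h ^+ 4 + (3 * m ^+ 4 + (4 * m ^+ 2 * A + 3 * A ^+ 2)) <=
  4 * m ^+ 3 * h + (4 * m ^+ 2 * A + 3 * A ^+ 2) * (N + 1) ^+ 2)%R.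
Proof.
move=> m0 N0 A0 hN; set t := (h - m)%R in hN.
have -> : h = (m + t)%R by rewrite /t; ring.
have t4 : (t ^+ 2 ^+ 2 <= (N * A) ^+ 2)%R.
  by rewrite ler_sqr ?nnegrE ?sqr_ge0// mulr_ge0.
have mt : (m ^+ 2 * t ^+ 2 <= m ^+ 2 * (N * A))%R by rewrite ler_wpM2l ?sqr_ge0.
have : (0 <= (m - t) ^+ 2 * t ^+ 2)%R by rewrite mulr_ge0 ?sqr_ge0.
have : (0 <= A ^+ 2 * N)%R by rewrite mulr_ge0 ?sqr_ge0.
have : (0 <= m ^+ 2 * A * N ^+ 2)%R by rewrite !mulr_ge0 ?sqr_ge0.
move: t4 mt; clear; nra.
Qed.

Lemma integral_cstT d (T : measurableType d) (P : probability T R) (c : \bar R) :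
  \int[P]_t c = c.
Proof.
have -> : \int[P]_t c = c * P setT by exact: (integral_cst P measurableT c).
have -> : P setT = 1 by exact: probability_setT.
exact: mule1.
Qed.

(** The L^p norm of a nonnegative function. Extended values make the norm of a slice of a
    function an admissible argument again, as induction on the dimension requires. *)
Definition pnorm d (T : measurableType d) (P : set T -> \bar R) (p : R)
    (f : T -> \bar R) : \bar R :=
  (\int[P]_t (f t) `^ p) `^ p^-1.

Lemma measurable_poweR_comp d (T : measurableType d) (f : T -> \bar R) (p : R) :
  measurable_fun setT f -> measurable_fun setT (fun t => f t `^ p).
Proof. by move=> mf; exact: measurableT_comp (measurable_poweR p) mf. Qed.

(** By this identity the norm for a product measure is the norm of the norms of the slices. *)
Lemma pnorm_pow d (T : measurableType d) (P : {measure set T -> \bar R})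
    (p : R) (f : T -> \bar R) : (0 < p)%R ->
  pnorm P p f `^ p = \int[P]_t (f t) `^ p.
Proof.
move=> p0; rewrite /pnorm -poweRrM mulVf ?gt_eqF// poweRe1//.
by apply: integral_ge0 => t _; exact: poweR_ge0.
Qed.

Lemma pnorm_le_bound d (T : measurableType d) (P : probability T R)
    (p C : R) (f : T -> \bar R) : (0 < p)%R -> measurable_fun setT f ->
  (forall t, 0 <= f t <= C%:E) -> pnorm P p f <= C%:E.
Proof.
move=> p0 mf fC.
have C0 : 0 <= C%:E.
  by have /andP[] := fC point; exact: le_trans.
rewrite -[leRHS]poweRe1// -(@mulfV _ p) ?gt_eqF// poweRrM /pnorm.
have bnd : \int[P]_t (f t) `^ p <= C%:E `^ p.
  apply: (@le_trans _ _ (\int[P]_t (C%:E `^ p))).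
    apply: le_integral_nonmeasurable => t; first exact: poweR_ge0.
    have /andP[f0 fc] := fC t.
    by apply: gt0_ler_poweR => //; rewrite ?ltW// in_itv/= ?f0 ?C0 leey.
  by rewrite integral_cstT.
apply: gt0_ler_poweR => //; rewrite ?invr_ge0 ?ltW// in_itv/= leey andbT.
  by apply: integral_ge0 => t _; exact: poweR_ge0.
by rewrite lee_fin powR_ge0.
Qed.

Lemma pnorm_ge0 d (T : measurableType d) (P : set T -> \bar R)
    (p : R) (f : T -> \bar R) : 0 <= pnorm P p f.
Proof. exact: poweR_ge0. Qed.

Lemma bounded_mean d (T : measurableType d) (P : probability T R) (C : R) (f : T -> \bar R) :
  (forall t, 0 <= f t <= C%:E) -> exists2 a : R, (0 <= a)%R & \int[P]_t f t = a%:E.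
Proof.
move=> fC.
have I0 : 0 <= \int[P]_t f t by apply: integral_ge0 => t _; case/andP: (fC t).
have I1 : \int[P]_t f t <= C%:E.
  apply: (@le_trans _ _ (\int[P]_t C%:E)).
    by apply: le_integral_nonmeasurable => t; case/andP: (fC t).
  by rewrite integral_cstT.
exists (fine (\int[P]_t f t)); first exact: fine_ge0.
by rewrite fineK// ge0_fin_numE// (le_lt_trans I1)// ltry.
Qed.

(** The noise operator with r <= 1/4 maps L2 to L4 with norm 1. As [mehler r x] has mean 1
    and squared norm [mehler (r ^+ 2) x x], [covariance_sqr_le] bounds (h x - m)^2 by
    (mehler (r^2) x x - 1) A at each x, where m and A are the mean and the variance of g.
    With [fourth_moment_bound] and [integral_mehler_diag] the fourth moment of h is at most
    m^4 + (4/3) m^2 A + A^2, which is at most (A + m^2)^2. *)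
Lemma mehler_two_four r (C : R) (g : measurableTypeR R -> R) (h : measurableTypeR R -> R) :
  (0 <= r <= 4^-1)%R -> measurable_fun setT g -> (forall y, 0 <= g y <= C)%R ->
  measurable_fun setT h ->
  (forall x, \int[mu]_y (g y * mehler r x y)%:E = (h x)%:E) ->
  \int[mu]_x (h x ^+ 4)%:E <= (\int[mu]_y (g y ^+ 2)%:E) ^+ 2.
Proof.
move=> /andP[r0 r4] mg gC mh hE.
have r01 : (0 <= r < 1)%R by rewrite r0/=; lra.
have g0 y : (0 <= g y)%R by case/andP: (gC y).
have [m m0 mE] : exists2 m, (0 <= m)%R & \int[mu]_y (g y)%:E = m%:E.
  by apply: (bounded_mean _ (C := C)) => y; rewrite !lee_fin.
have [be be0 beE] : exists2 b, (0 <= b)%R & \int[mu]_y (g y ^+ 2)%:E = b%:E.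
  apply: (bounded_mean _ (C := (C ^+ 2)%R)) => y; rewrite !lee_fin sqr_ge0/=.
  have /andP[? gc] := gC y; rewrite ler_sqr// nnegrE//; exact: le_trans gc.
have mk x : measurable_fun setT (fun y : measurableTypeR R => mehler r x y).
  exact: measurable_mehler.
have kk x : \int[mu]_y (mehler r x y ^+ 2)%:E = (mehler (r ^+ 2) x x)%:E.
  rewrite -(mehler_semigroup x x r01); apply: eq_integral => y _.
  by rewrite expr2 mehlerC.
have kg x : \int[mu]_y (mehler r x y * g y)%:E = (h x)%:E.
  by rewrite -hE; apply: eq_integral => y _; rewrite mulrC.
have varb x := covariance_sqr_le (mk x) mg (fun y => mehler_ge0 _ _ _) g0
  (integral_mehler x r01) mE (kk x) beE (kg x).
have A0 : (0 <= be - m ^+ 2)%R by case: (varb 0%R).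
have hb x : ((h x - m) ^+ 2 <= (mehler (r ^+ 2) x x - 1) * (be - m ^+ 2))%R.
  by case: (varb x) => _ _; rewrite mul1r expr1n.
have N0 x : (0 <= mehler (r ^+ 2) x x - 1)%R by case: (varb x) => + _ _; rewrite expr1n.
set A := (be - m ^+ 2)%R in A0 hb.
set c := (4 * m ^+ 2 * A + 3 * A ^+ 2)%R.
have c0 : (0 <= c)%R by rewrite addr_ge0// !mulr_ge0// ?sqr_ge0.
have h0 x : (0 <= h x)%R.
  rewrite -lee_fin -hE; apply: integral_ge0 => y _.
  by rewrite lee_fin mulr_ge0// mehler_ge0.
have hm : \int[mu]_x (h x)%:E = m%:E.
  under eq_integral do rewrite -hE.
  rewrite tonelli.
  - rewrite -mE; apply: eq_integral => y _.
    under eq_integral do rewrite EFinM mehlerC.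
    rewrite ge0_integralZlT ?lee_fin//.
    + by rewrite integral_mehler// mule1.
    + by apply/measurable_EFinP.
    + by move=> x; rewrite lee_fin mehler_ge0.
  - apply/measurable_EFinP; apply: measurable_funM.
      exact: measurableT_comp mg measurable_snd.
    by apply: measurable_mehler.
  - by move=> x y; rewrite lee_fin mulr_ge0// mehler_ge0.
have md : measurable_fun setT (fun x : measurableTypeR R => mehler (r ^+ 2) x x).
  exact: measurable_mehler.
have s16 : (0 <= r ^+ 2 <= 16^-1)%R.
  by rewrite sqr_ge0/=; nra.
have main : \int[mu]_x (h x ^+ 4)%:E + (3 * m ^+ 4 + c)%:E <=
    (4 * m ^+ 3 * m + c * (4 / 3))%:E.
  have -> : (3 * m ^+ 4 + c)%:E = \int[mu]_x (3 * m ^+ 4 + c)%:E.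
    by rewrite integral_cstT.
  rewrite -ge0_integralDT; first last.
  - by move=> x; rewrite lee_fin addr_ge0// mulr_ge0// exprn_ge0.
  - exact: measurable_cst.
  - by move=> x; rewrite lee_fin exprn_ge0.
  - by apply/measurable_EFinP; exact: measurable_funX.
  apply: (@le_trans _ _ (\int[mu]_x ((4 * m ^+ 3)%:E * (h x)%:E +
      c%:E * (mehler (r ^+ 2) x x ^+ 2)%:E))).
    apply: le_integral_nonmeasurable => x.
      by rewrite lee_fin addr_ge0 ?exprn_ge0// addr_ge0// mulr_ge0// exprn_ge0.
    rewrite -!EFinM -!EFinD lee_fin.
    have := fourth_moment_bound m0 (N0 x) A0 (hb x).
    by rewrite subrK -/c.
  rewrite ge0_integralDT; first last.
  - by move=> x; rewrite mule_ge0// lee_fin ?exprn_ge0// mehler_ge0.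
  - by apply: measurable_funeM; apply/measurable_EFinP; exact: measurable_funX.
  - by move=> x; rewrite mule_ge0// lee_fin ?mulr_ge0 ?exprn_ge0.
  - by apply: measurable_funeM; apply/measurable_EFinP.
  rewrite !ge0_integralZlT; first last.
  - by rewrite lee_fin mulr_ge0// exprn_ge0.
  - by move=> x; rewrite lee_fin.
  - exact/measurable_EFinP.
  - by rewrite lee_fin.
  - by move=> x; rewrite lee_fin sqr_ge0.
  - by apply/measurable_EFinP; exact: measurable_funX.
  rewrite hm (EFinD (4 * m ^+ 3 * m)%R); apply: leeD; first by rewrite -EFinM.
  by rewrite (EFinM c); apply: lee_wpmul2l; [rewrite lee_fin|exact: integral_mehler_diag].
have [H H0 HE] : exists2 H, (0 <= H)%R & \int[mu]_x (h x ^+ 4)%:E = H%:E.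
  exists (fine (\int[mu]_x (h x ^+ 4)%:E)).
    by apply: fine_ge0; apply: integral_ge0 => x _; rewrite lee_fin exprn_ge0.
  rewrite fineK// ge0_fin_numE; last first.
    by apply: integral_ge0 => x _; rewrite lee_fin exprn_ge0.
  move: main; case: (\int[mu]_x (h x ^+ 4)%:E) => // x _.
  exact: ltry.
move: main; rewrite HE beE -EFin_expe -EFinD !lee_fin => main.
(* (A + m^2)^2 exceeds m^4 + (4/3) m^2 A + A^2 by (2/3) m^2 A. *)
have -> : be = (A + m ^+ 2)%R by rewrite /A subrK.
have : (0 <= m ^+ 2 * A)%R by rewrite mulr_ge0// sqr_ge0.
move: main; rewrite /c; nra.
Qed.

(** The dual form of [mehler_two_four], by the Hoelder inequality with exponents 4/3 and 4. *)
Lemma hypercontractive1 r (C : R) (f g : measurableTypeR R -> \bar R) :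
  (0 <= r <= 4^-1)%R ->
  measurable_fun setT f -> (forall x, 0 <= f x <= C%:E) ->
  measurable_fun setT g -> (forall x, 0 <= g x <= C%:E) ->
  \int[mu]_x \int[mu]_y (f x * g y * (mehler r x y)%:E) <=
  pnorm mu (4 / 3) f * pnorm mu 2 g.
Proof.
move=> r4 mf fC mg gC.
have real (u : measurableTypeR R -> \bar R) : measurable_fun setT u ->
    (forall x, 0 <= u x <= C%:E) -> exists v : measurableTypeR R -> R,
    [/\ u = EFin \o v, measurable_fun setT v & forall x, (0 <= v x <= C)%R].
  move=> mu_ uC; exists (fine \o u).
  have uE : u = EFin \o (fine \o u).
    apply/funext => x /=; rewrite fineK// ge0_fin_numE; case/andP: (uC x) => // _.
    by move/le_lt_trans; apply; exact: ltry.
  split => //; first exact: measurableT_comp (fine_measurable measurableT) mu_.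
  by move=> x; rewrite -!lee_fin; have := uC x; rewrite {1 2}uE.
have [F [fE mF FC]] := real f mf fC.
have [G [gE mG GC]] := real g mg gC.
move: mf fC mg gC; rewrite fE gE => _ _ _ _; clear fE gE real f g.
have F0 x : (0 <= F x)%R by case/andP: (FC x).
have G0 x : (0 <= G x)%R by case/andP: (GC x).
have r01 : (0 <= r < 1)%R by case/andP: r4 => -> /= ?; lra.
have mk x : measurable_fun setT (fun y : measurableTypeR R => mehler r x y).
  exact: measurable_mehler.
have Gk0 x y : 0 <= (G y * mehler r x y)%:E by rewrite lee_fin mulr_ge0// mehler_ge0.
have mGk : measurable_fun setT (fun p : measurableTypeR R * measurableTypeR R =>
    (G p.2 * mehler r p.1 p.2)%:E).
  apply/measurable_EFinP; apply: measurable_funM.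
    exact: measurableT_comp mG measurable_snd.
  exact: measurable_mehler.
pose h x := fine (\int[mu]_y (G y * mehler r x y)%:E).
have hE x : \int[mu]_y (G y * mehler r x y)%:E = (h x)%:E.
  rewrite /h fineK// ge0_fin_numE; last exact: integral_ge0.
  apply: (@le_lt_trans _ _ C%:E); last exact: ltry.
  rewrite -[leRHS]mule1 -(integral_mehler x r01) -ge0_integralZlT//.
  - apply: le_integral_nonmeasurable => // y; rewrite -EFinM lee_fin.
    by rewrite ler_wpM2r ?mehler_ge0//; case/andP: (GC y).
  - by apply/measurable_EFinP.
  - by move=> y; rewrite lee_fin mehler_ge0.
  - by rewrite lee_fin; case/andP: (GC 0%R); exact: le_trans.
have h0 x : (0 <= h x)%R by rewrite -lee_fin -hE; exact: integral_ge0.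
have mh : measurable_fun setT h.
  apply/measurable_EFinP; rewrite (_ : _ \o _ = fun x =>
    \int[mu]_y (G y * mehler r x y)%:E); last by apply/funext => x /=; rewrite hE.
  exact: (measurable_integralr mu mGk).
have h4 := mehler_two_four r4 mG GC mh hE.
have -> : \int[mu]_x \int[mu]_y ((EFin \o F) x * (EFin \o G) y * (mehler r x y)%:E) =
    'N[mu]_1[EFin \o (F \* h)%R].
  rewrite Lnorm1; apply: eq_integral => x _ /=.
  rewrite ger0_norm ?mulr_ge0// EFinM -hE -ge0_integralZlT//.
  - by apply: eq_integral => y _; rewrite (EFinM (G y)) muleA.
  - by apply/measurable_EFinP; exact: measurable_funM.
  - by rewrite lee_fin.
apply: (le_trans (@hoelder _ _ _ mu F h (4 / 3) 4 mF mh _ _ _)) => //.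
  by field.
have -> : 'N[mu]_(4 / 3)%:E[EFin \o F] = pnorm mu (4 / 3) (EFin \o F).
  rewrite unlock; apply: (congr1 (fun u => u `^ (4 / 3)^-1)).
  by apply: eq_integral => x _ /=; rewrite ger0_norm.
apply: lee_wpmul2l; first exact: pnorm_ge0.
have -> : 'N[mu]_4%:E[EFin \o h] = (\int[mu]_x (h x ^+ 4)%:E) `^ 4^-1.
  rewrite unlock; congr (_ `^ _); apply: eq_integral => x _ /=.
  by rewrite ger0_norm// powR_mulrn.
have -> : pnorm mu 2 (EFin \o G) = ((\int[mu]_y (G y ^+ 2)%:E) ^+ 2) `^ 4^-1.
  rewrite /pnorm.
  have -> : \int[mu]_t (EFin \o G) t `^ 2 = \int[mu]_y (G y ^+ 2)%:E.
    by apply: eq_integral => y _ /=; rewrite powR_mulrn.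
  have I0 : 0 <= \int[mu]_y (G y ^+ 2)%:E.
    by apply: integral_ge0 => y _; rewrite lee_fin sqr_ge0.
  case: (\int[mu]_y (G y ^+ 2)%:E) I0 => [b| |//].
    rewrite lee_fin -EFin_expe => b0; rewrite !poweR_EFin; congr EFin.
    rewrite -powR_mulrn// -powRrM; congr (_ `^ _)%R.
    by field.
  by move=> _; rewrite expe2 mulyy !poweRyr// invr_eq0.
apply: gt0_ler_poweR => //; rewrite in_itv/= leey andbT.
  by apply: integral_ge0 => x _; rewrite lee_fin exprn_ge0.
by apply: mule_ge0; apply: integral_ge0 => x _; rewrite lee_fin sqr_ge0.
Qed.

(** Hypercontractivity in its two-function form tensorizes by a plain induction: for fixed
    first coordinates x and y the induction hypothesis bounds the inner integrals by the
    product of the norms of the slices f (x, .) and g (y, .), and the one-dimensional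
    inequality applies to these norms as functions of x and y. *)
Lemma hypercontractive r (C : R) n (f g : euclid R n -> \bar R) :
  (0 <= r <= 4^-1)%R ->
  measurable_fun setT f -> (forall x, 0 <= f x <= C%:E) ->
  measurable_fun setT g -> (forall x, 0 <= g x <= C%:E) ->
  \int[gaussian R n]_X \int[gaussian R n]_Y (f X * g Y * (kernel r X Y)%:E) <=
  pnorm (gaussian R n) (4 / 3) f * pnorm (gaussian R n) 2 g.
Proof.
move=> r4; elim: n f g => [|n IHn] f g mf fC mg gC.
  have f0 x : 0 <= f x by case/andP: (fC x).
  have g0 x : 0 <= g x by case/andP: (gC x).
  rewrite /pnorm !integral_gaussian0// -!poweRrM !mulfV ?poweRe1//.
  by rewrite kernel_nil mule1.
have f0 x : 0 <= f x by case/andP: (fC x).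
have g0 x : 0 <= g x by case/andP: (gC x).
have fgk0 X Y : 0 <= f X * g Y * (kernel r X Y)%:E.
  by rewrite !mule_ge0// lee_fin kernel_ge0.
have mk d (T : measurableType d) m (a b : T -> euclid R m) :
    measurable_fun setT a -> measurable_fun setT b ->
    measurable_fun setT (fun t => (kernel r (a t) (b t))%:E).
  by move=> ma mb; apply/measurable_EFinP; exact: measurable_kernel.
have mfgk d (T : measurableType d) (a b : T -> euclid R n.+1) :
    measurable_fun setT a -> measurable_fun setT b ->
    measurable_fun setT (fun t => f (a t) * g (b t) * (kernel r (a t) (b t))%:E).
  move=> ma mb; apply: emeasurable_funM; last exact: mk.
  by apply: emeasurable_funM; [exact: measurableT_comp mf ma|exact: measurableT_comp mg mb].
pose F x := pnorm (gaussian R n) (4 / 3) (fun X => f [tuple of x :: X]).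
pose G x := pnorm (gaussian R n) 2 (fun X => g [tuple of x :: X]).
have mcons : measurable_fun setT (fun p : measurableTypeR R * euclid R n =>
    [tuple of p.1 :: p.2] : euclid R n.+1).
  exact: measurable_cons.
have mfx x : measurable_fun setT (fun X : euclid R n => f [tuple of x :: X]).
  exact: measurableT_comp mf (measurable_consl _).
have mgx x : measurable_fun setT (fun X : euclid R n => g [tuple of x :: X]).
  exact: measurableT_comp mg (measurable_consl _).
have mpn (u : euclid R n.+1 -> \bar R) p : measurable_fun setT u ->
    measurable_fun setT (fun x =>
      pnorm (gaussian R n) p (fun X => u [tuple of x :: X])).
  move=> mu_; apply: measurable_poweR_comp.
  apply: (measurable_integralr (gaussian R n)) => [|x y]; last exact: poweR_ge0.
  by apply: measurable_poweR_comp; exact: measurableT_comp mu_ mcons.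
have mF : measurable_fun setT F by exact: mpn.
have mG : measurable_fun setT G by exact: mpn.
have FC x : 0 <= F x <= C%:E by rewrite pnorm_ge0/= pnorm_le_bound.
have GC x : 0 <= G x <= C%:E by rewrite pnorm_ge0/= pnorm_le_bound.
have pnE (u : euclid R n.+1 -> \bar R) p : (0 < p)%R -> measurable_fun setT u ->
    pnorm (gaussian R n.+1) p u =
    pnorm mu p (fun x => pnorm (gaussian R n) p (fun X => u [tuple of x :: X])).
  move=> p0 mu_; rewrite {1}/pnorm integral_gaussianS; last 2 first.
  - exact: measurable_poweR_comp.
  - by move=> x; exact: poweR_ge0.
  rewrite /pnorm -/(pnorm mu p _); congr (_ `^ _); apply: eq_integral => x _.
  by rewrite -/(pnorm _ _ _) pnorm_pow.
rewrite !pnE//; apply: le_trans (hypercontractive1 r4 mF FC mG GC).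
rewrite integral_gaussianS; last 2 first.
- apply: (measurable_integralr (gaussian R n.+1)) => // .
  exact: mfgk.
- by move=> X; exact: integral_ge0.
apply: le_integral_nonmeasurable => x.
  by do 2 (apply: integral_ge0 => ? _).
have step (X : euclid R n) : \int[gaussian R n.+1]_Y
     (f [tuple of x :: X] * g Y * (kernel r [tuple of x :: X] Y)%:E) =
   \int[mu]_y \int[gaussian R n]_Y
     (f [tuple of x :: X] * g [tuple of y :: Y] *
      (kernel r [tuple of x :: X] [tuple of y :: Y])%:E).
  by apply: integral_gaussianS => //; exact: mfgk.
under eq_integral do rewrite step.
rewrite tonelli; first last.
- by move=> X y; exact: integral_ge0.
- apply: (measurable_integralr (gaussian R n)
    (f := fun (p : euclid R n * measurableTypeR R) Y =>
      f [tuple of x :: p.1] * g [tuple of p.2 :: Y] *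
      (kernel r [tuple of x :: p.1] [tuple of p.2 :: Y])%:E)) => //.
  apply: mfgk.
    exact: measurableT_comp (measurable_consl x)
      (measurableT_comp measurable_fst measurable_fst).
  apply: measurable_cons => //; exact: measurableT_comp measurable_snd measurable_fst.
apply: le_integral_nonmeasurable => y.
  by do 2 (apply: integral_ge0 => ? _).
have IH := IHn _ _ (mfx x) (fun X => fC _) (mgx y) (fun X => gC _).
rewrite [leRHS]muleC; apply: le_trans (lee_wpmul2l _ IH); last first.
  by rewrite lee_fin mehler_ge0.
rewrite -ge0_integralZlT; first last.
- by rewrite lee_fin mehler_ge0.
- by move=> X; apply: integral_ge0 => Y _; rewrite !mule_ge0// lee_fin kernel_ge0.
- apply: (measurable_integralr (gaussian R n)) => [|X Y]; last first.
    by rewrite !mule_ge0// lee_fin kernel_ge0.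
  apply: emeasurable_funM; last exact: mk.
  by apply: emeasurable_funM;
    [exact: measurableT_comp (mfx x) measurable_fst
    |exact: measurableT_comp (mgx y) measurable_snd].
apply: le_integral_nonmeasurable => X; first exact: integral_ge0.
rewrite -ge0_integralZlT; first last.
- by rewrite lee_fin mehler_ge0.
- by move=> Y; rewrite !mule_ge0// lee_fin kernel_ge0.
- apply: emeasurable_funM; last exact: mk.
  by apply: measurable_funeM; exact: mgx.
apply: le_integral_nonmeasurable => Y; first exact: fgk0.
by rewrite kernel_cons EFinM muleCA.
Qed.

End hypercontractivity.

(** * Functions with values in the unit interval and their influences *)

Section unit_functions.
Variable R : realType.
Local Notation mu := (@normal_prob R 0 1).
Local Notation gam := (@gaussian R).
Implicit Types r : R.
Local Open Scope ereal_scope.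

Definition unit_fun d (T : measurableType d) (f : T -> R) :=
  measurable_fun setT f /\ forall t, (0 <= f t <= 1)%R.

Lemma unit_fun_comp d1 d2 (T1 : measurableType d1) (T2 : measurableType d2)
    (f : T2 -> R) (h : T1 -> T2) :
  unit_fun f -> measurable_fun setT h -> unit_fun (f \o h).
Proof. by move=> [mf f01] mh; split; [exact: measurableT_comp mf mh|move=> t; exact: f01]. Qed.

Lemma le_mean_abs d (T : measurableType d) (P : probability T R) (f g : T -> R) (a b : R) :
  unit_fun f -> unit_fun g ->
  \int[P]_t (f t)%:E = a%:E -> \int[P]_t (g t)%:E = b%:E ->
  `|a - b|%:E <= \int[P]_t (`|f t - g t|)%:E.
Proof.
have half (u v : T -> R) x y : unit_fun u -> unit_fun v ->
    \int[P]_t (u t)%:E = x%:E -> \int[P]_t (v t)%:E = y%:E ->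
    x%:E <= y%:E + \int[P]_t (`|u t - v t|)%:E.
  move=> [mu_ u01] [mv v01] <- <-; rewrite -ge0_integralDT.
  - apply: le_integral_nonmeasurable => t; have /andP[u0 _] := u01 t;
      rewrite -?EFinD lee_fin//.
    by rewrite -lerBlDl ler_norm.
  - exact/measurable_EFinP.
  - by move=> t; have /andP[v0 _] := v01 t; rewrite lee_fin.
  - by apply/measurable_EFinP; apply: measurableT_comp => //; exact: measurable_funB.
  - by move=> t; rewrite lee_fin.
move=> uf ug fa gb.
have h1 := half _ _ _ _ uf ug fa gb.
have h2 := half _ _ _ _ ug uf gb fa.
have e : \int[P]_t (`|g t - f t|)%:E = \int[P]_t (`|f t - g t|)%:E.
  by apply: eq_integral => t _; rewrite distrC.
rewrite e in h2.
have I0 : 0 <= \int[P]_t (`|f t - g t|)%:E by apply: integral_ge0 => t _; rewrite lee_fin.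
move: h1 h2 I0; case: (\int[P]_t (`|f t - g t|)%:E) => [I| |]//; last by rewrite !leey.
rewrite -!EFinD !lee_fin => h1 h2 _; rewrite ler_norml; apply/andP; split; lra.
Qed.

Lemma unit_mean d (T : measurableType d) (P : probability T R) (f : T -> R) :
  unit_fun f -> exists2 a : R, (0 <= a <= 1)%R & \int[P]_t (f t)%:E = a%:E.
Proof.
move=> [mf f01].
have I0 : 0 <= \int[P]_t (f t)%:E.
  by apply: integral_ge0 => t _; rewrite lee_fin; case/andP: (f01 t).
have I1 : \int[P]_t (f t)%:E <= 1.
  rewrite -[leRHS](integral_cstT P 1).
  by apply: le_integral_nonmeasurable => t; rewrite lee_fin; case/andP: (f01 t).
have fin : \int[P]_t (f t)%:E \is a fin_num by rewrite ge0_fin_numE// (le_lt_trans I1)// ltry.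
exists (fine (\int[P]_t (f t)%:E)); last by rewrite fineK.
by rewrite fine_ge0//= -lee_fin fineK.
Qed.

Lemma unit_sqr d (T : measurableType d) (f : T -> R) :
  unit_fun f -> unit_fun (fun t => f t ^+ 2)%R.
Proof.
move=> [mf f01]; split; first exact: measurable_funX.
by move=> t; have /andP[f0 f1] := f01 t; rewrite sqr_ge0 expr_le1.
Qed.

Lemma mean_variance d (T : measurableType d) (P : probability T R) (f : T -> R) (a : R) :
  unit_fun f -> \int[P]_t (f t)%:E = a%:E ->
  \int[P]_t ((f t - a) ^+ 2)%:E + (a ^+ 2)%:E = \int[P]_t (f t ^+ 2)%:E.
Proof.
move=> uf fa; have [mf f01] := uf.
have a0 : (0 <= a)%R.
  rewrite -lee_fin -fa; apply: integral_ge0 => t _; rewrite lee_fin.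
  by case/andP: (f01 t).
have [s _ sE] := unit_mean P (unit_sqr uf).
have mfa : measurable_fun setT (fun t => ((f t - a) ^+ 2)%:E).
  by apply/measurable_EFinP; apply: measurable_funX; exact: measurable_funB.
have : \int[P]_t (((f t - a) ^+ 2)%:E + (2 * a)%:E * (f t)%:E) =
       \int[P]_t ((f t ^+ 2)%:E + (a ^+ 2)%:E).
  by apply: eq_integral => t _; rewrite -EFinM -!EFinD; congr EFin; ring.
rewrite !ge0_integralDT//; first last.
- by move=> t; rewrite mule_ge0 ?lee_fin ?mulr_ge0//; case/andP: (f01 t).
- by apply: measurable_funeM; exact/measurable_EFinP.
- by move=> t; rewrite lee_fin sqr_ge0.
- by move=> t; rewrite lee_fin sqr_ge0.
- by move=> t; rewrite lee_fin sqr_ge0.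
- by apply/measurable_EFinP; exact: measurable_funX.
rewrite ge0_integralZlT; first last.
- by rewrite lee_fin mulr_ge0.
- by move=> t; rewrite lee_fin; case/andP: (f01 t).
- exact/measurable_EFinP.
rewrite integral_cstT fa sE.
have V0 : 0 <= \int[P]_t ((f t - a) ^+ 2)%:E.
  by apply: integral_ge0 => t _; rewrite lee_fin sqr_ge0.
case: (\int[P]_t ((f t - a) ^+ 2)%:E) V0 => [v| |]// _.
rewrite -EFinM -!EFinD => -[h]; congr EFin; move: h; lra.
Qed.

(** By Hoelder the product of the norms is at most A^(1/2) B^(3/4), that is the
    geometric mean of p = lam^3 A^2 and q = lam^-1 B with weights 1/4 and 3/4. Comparing
    fourth powers, it remains to see that p q^3 <= (p + q)^4. *)
Lemma interpolate d (T : measurableType d) (P : probability T R) (u : T -> R)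
    (A B lam : R) : (0 < lam)%R -> unit_fun u ->
  \int[P]_t (u t)%:E = A%:E -> \int[P]_t (u t ^+ 2)%:E = B%:E ->
  pnorm P (4 / 3) (EFin \o u) * pnorm P 2 (EFin \o u) <=
  (lam ^+ 3 * A ^+ 2 + lam^-1 * B)%:E.
Proof.
move=> l0 [mu_ u01] uA uB; have l1 := ltW l0.
have li : (0 <= lam^-1)%R by rewrite invr_ge0.
have u0 t : (0 <= u t)%R by case/andP: (u01 t).
have A0 : (0 <= A)%R.
  by rewrite -lee_fin -uA; apply: integral_ge0 => t _; rewrite lee_fin.
have B0 : (0 <= B)%R.
  by rewrite -lee_fin -uB; apply: integral_ge0 => t _; rewrite lee_fin sqr_ge0.
have -> : pnorm P 2 (EFin \o u) = (Num.sqrt B)%:E.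
  rewrite /pnorm (_ : \int[P]_t _ = B%:E) ?poweR_EFin ?powR12_sqrt//.
  by rewrite -uB; apply: eq_integral => t _ /=; rewrite powR_mulrn.
have mp p : measurable_fun setT (fun t => u t `^ p)%R.
  exact: measurableT_comp (measurable_powR p) mu_.
have bnd : \int[P]_t (EFin \o u) t `^ (4 / 3) <=
    (A `^ (3 / 2)^-1 * B `^ 3^-1)%:E.
  have := @hoelder _ _ _ P (fun t => u t `^ (2 / 3))%R (fun t => u t `^ (2 / 3))%R
    (3 / 2) 3 (mp _) (mp _) _ _ _.
  rewrite Lnorm1 unlock /=.
  rewrite (_ : \int[P]_x (`|u x `^ (2 / 3)| `^ (3 / 2))%:E = A%:E); last first.
    rewrite -uA; apply: eq_integral => t _; rewrite ger0_norm ?powR_ge0// -powRrM.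
    by rewrite (_ : 2 / 3 * (3 / 2) = 1 :> R)%R ?powRr1//; field.
  rewrite (_ : \int[P]_x (`|u x `^ (2 / 3)| `^ 3)%:E = B%:E); last first.
    rewrite -uB; apply: eq_integral => t _; rewrite ger0_norm ?powR_ge0// -powRrM.
    by rewrite (_ : 2 / 3 * 3 = 2 :> R)%R ?powR_mulrn//; field.
  rewrite (_ : \int[P]_x _ = \int[P]_t (EFin \o u) t `^ (4 / 3)); last first.
    apply: eq_integral => t _ /=; rewrite ger0_norm ?mulr_ge0 ?powR_ge0//.
    congr EFin; have [->|ut] := eqVneq (u t) 0%R.
      by rewrite !powR0 ?mulr0//; apply/eqP; lra.
    rewrite -powRD ?ut ?implybT//; congr (_ `^ _)%R; by field.
  rewrite !poweR_EFin -EFinM; apply => //; by field.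
have t0 : 0 <= \int[P]_t (EFin \o u) t `^ (4 / 3).
  by apply: integral_ge0 => t _; exact: poweR_ge0.
rewrite /pnorm; move: t0 bnd.
case: (\int[P]_t (EFin \o u) t `^ (4 / 3)) => [t| |]//.
move=> t0 bnd; rewrite !lee_fin in t0 bnd; rewrite poweR_EFin -EFinM lee_fin.
have P0 : (0 <= lam ^+ 3 * A ^+ 2)%R by rewrite mulr_ge0 ?exprn_ge0// ltW.
have Q0 : (0 <= lam^-1 * B)%R by rewrite mulr_ge0// invr_ge0 ltW.
rewrite -(@ler_pXn2r _ 4)// ?nnegrE ?addr_ge0 ?mulr_ge0 ?powR_ge0 ?sqrtr_ge0//.
have t3 : (t ^+ 3 <= A ^+ 2 * B)%R.
  apply: le_trans (_ : (A `^ (3 / 2)^-1 * B `^ 3^-1) ^+ 3 <= _)%R.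
    by rewrite lerXn2r ?nnegrE// mulr_ge0 ?powR_ge0.
  rewrite exprMn -!powR_mulrn ?powR_ge0// -!powRrM.
  rewrite (_ : (3 / 2)^-1 * 3%:R = 2 :> R)%R; last by field.
  by rewrite mulVf// powRr1.
have -> : ((t `^ (4 / 3)^-1 * Num.sqrt B) ^+ 4 = t ^+ 3 * B ^+ 2)%R.
  rewrite exprMn; congr (_ * _)%R.
    rewrite -!powR_mulrn ?powR_ge0// -powRrM; congr (_ `^ _)%R; by field.
  by rewrite (exprM _ 2 2) sqr_sqrtr.
apply: le_trans (_ : lam ^+ 3 * A ^+ 2 * (lam^-1 * B) ^+ 3 <= _)%R.
  rewrite [leRHS](_ : _ = A ^+ 2 * B * B ^+ 2)%R; last by field; rewrite gt_eqF.
  by rewrite ler_wpM2r ?sqr_ge0.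
move: (lam ^+ 3 * A ^+ 2)%R (lam^-1 * B)%R P0 Q0 => p q p0 q0.
rewrite [leRHS](_ : _ = p * q ^+ 3 + (p ^+ 4 + 4 * p ^+ 3 * q +
  6 * p ^+ 2 * q ^+ 2 + 3 * p * q ^+ 3 + q ^+ 4))%R; last by ring.
by rewrite lerDl !addr_ge0// !mulr_ge0// exprn_ge0.
Qed.

Definition avg n (f : euclid R n.+1 -> R) (X : euclid R n) : R :=
  fine (\int[mu]_x (f [tuple of x :: X])%:E).

Lemma measurable_consr n (X : euclid R n) : measurable_fun setT
  (fun x : measurableTypeR R => [tuple of x :: X] : euclid R n.+1).
Proof. exact: measurable_cons. Qed.

Lemma measurable_cons2 n : measurable_fun setT
  (fun p : measurableTypeR R * euclid R n => [tuple of p.1 :: p.2] : euclid R n.+1).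
Proof. exact: measurable_cons. Qed.

Lemma avgE n (f : euclid R n.+1 -> R) (X : euclid R n) : unit_fun f ->
  \int[mu]_x (f [tuple of x :: X])%:E = (avg f X)%:E.
Proof.
move=> uf; have [a _ fa] := unit_mean mu (unit_fun_comp uf (measurable_consr X)).
by rewrite /avg; move: fa => /= ->.
Qed.

Lemma unit_avg n (f : euclid R n.+1 -> R) : unit_fun f -> unit_fun (avg f).
Proof.
move=> uf; have [mf f01] := uf; split.
  apply/measurable_EFinP; rewrite (_ : _ \o _ = fun X : euclid R n =>
    \int[mu]_x (f [tuple of x :: X])%:E); last by apply/funext => X; rewrite avgE.
  apply: (measurable_integrall mu (f := fun x (X : euclid R n) => (f [tuple of x :: X])%:E)).
    by apply/measurable_EFinP; exact: measurableT_comp mf (@measurable_cons2 n).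
  by move=> x X; rewrite lee_fin; case/andP: (f01 [tuple of x :: X]).
move=> X; have [a a01 fa] := unit_mean mu (unit_fun_comp uf (measurable_consr X)).
by rewrite /avg; move: fa => /= ->.
Qed.

Lemma integral_gaussianSr n (f : euclid R n.+1 -> \bar R) :
  measurable_fun setT f -> (forall x, 0 <= f x) ->
  \int[gam n.+1]_x f x = \int[gam n]_X \int[mu]_x f [tuple of x :: X].
Proof.
move=> mf f0; rewrite integral_gaussianS//; apply: tonelli => //.
exact: measurableT_comp mf (@measurable_cons2 n).
Qed.

Lemma integral_avg n (f : euclid R n.+1 -> R) : unit_fun f ->
  \int[gam n.+1]_X (f X)%:E = \int[gam n]_X (avg f X)%:E.
Proof.
move=> uf; have [mf f01] := uf; rewrite integral_gaussianSr.
- by apply: eq_integral => X _; rewrite avgE.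
- exact/measurable_EFinP.
- by move=> X; rewrite lee_fin; case/andP: (f01 X).
Qed.

(** The pairing of f with the image of g under the noise operator of correlation r, that is
    the mean of f (W) g (W') for standard Gaussian vectors of correlation r. *)
Definition noise_form r n (f g : euclid R n -> R) : \bar R :=
  \int[gam n]_X \int[gam n]_Y (f X * g Y * kernel r X Y)%:E.

Lemma measurable_noise_form r n (f g : euclid R n -> R) :
  measurable_fun setT f -> measurable_fun setT g ->
  measurable_fun setT (fun p : euclid R n * euclid R n =>
    (f p.1 * g p.2 * kernel r p.1 p.2)%:E).
Proof.
move=> mf mg; apply/measurable_EFinP; apply: measurable_funM.
  by apply: measurable_funM;
    [exact: measurableT_comp mf measurable_fst|exact: measurableT_comp mg measurable_snd].
exact: measurable_kernel.
Qed.

Lemma noise_formC r n (f g : euclid R n -> R) : unit_fun f -> unit_fun g ->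
  noise_form r f g = noise_form r g f.
Proof.
move=> [mf f01] [mg g01]; rewrite /noise_form tonelli.
- by apply: eq_integral => X _; apply: eq_integral => Y _; rewrite kernelC (mulrC (f Y)).
- exact: measurable_noise_form.
- move=> X Y; rewrite lee_fin mulr_ge0 ?kernel_ge0// mulr_ge0//.
    by case/andP: (f01 X).
  by case/andP: (g01 Y).
Qed.

Lemma noise_operator_unit r n (g : euclid R n -> R) (X : euclid R n) :
  (0 <= r < 1)%R -> unit_fun g ->
  exists2 q : R, (0 <= q <= 1)%R & \int[gam n]_Y (g Y * kernel r X Y)%:E = q%:E.
Proof.
move=> r01 [mg g01].
have I0 : 0 <= \int[gam n]_Y (g Y * kernel r X Y)%:E.
  apply: integral_ge0 => Y _; rewrite lee_fin mulr_ge0 ?kernel_ge0//.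
  by case/andP: (g01 Y).
have I1 : \int[gam n]_Y (g Y * kernel r X Y)%:E <= 1.
  rewrite -(integral_kernel X r01); apply: le_integral_nonmeasurable => Y.
    by rewrite lee_fin mulr_ge0 ?kernel_ge0//; case/andP: (g01 Y).
  by rewrite lee_fin ler_piMl ?kernel_ge0//; case/andP: (g01 Y).
have fin : \int[gam n]_Y (g Y * kernel r X Y)%:E \is a fin_num.
  by rewrite ge0_fin_numE// (le_lt_trans I1)// ltry.
exists (fine (\int[gam n]_Y (g Y * kernel r X Y)%:E)); last by rewrite fineK.
by rewrite fine_ge0//= -lee_fin fineK.
Qed.

Lemma noise_formE r n (f g : euclid R n -> R) : unit_fun f -> unit_fun g ->
  noise_form r f g =
  \int[gam n]_X ((f X)%:E * \int[gam n]_Y (g Y * kernel r X Y)%:E).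
Proof.
move=> [mf f01] [mg g01]; apply: eq_integral => X _.
rewrite -ge0_integralZlT.
- by apply: eq_integral => Y _; rewrite -EFinM mulrA.
- by apply/measurable_EFinP; apply: measurable_funM => //; exact: measurable_kernel.
- move=> Y; rewrite lee_fin mulr_ge0 ?kernel_ge0//.
  by case/andP: (g01 Y).
- by rewrite lee_fin; case/andP: (f01 X).
Qed.

Lemma noise_form_le1 r n (f g : euclid R n -> R) : (0 <= r < 1)%R ->
  unit_fun f -> unit_fun g -> noise_form r f g <= 1.
Proof.
move=> r01 uf ug; rewrite noise_formE//.
rewrite -[leRHS](integral_cstT (gam n) 1); have [_ f01] := uf.
have h X := noise_operator_unit X r01 ug.
apply: le_integral_nonmeasurable => X; have [q /andP[q0 q1] ->] := h X;
  have /andP[f0 f1] := f01 X; rewrite -EFinM lee_fin ?mulr_ge0//.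
by rewrite mulr_ile1.
Qed.

(** A function of all coordinates but the first, seen as a function of all coordinates.
    Thus [tail_fun (avg f)] is the conditional expectation of f given the other
    coordinates. *)
Definition tail_fun n (g : euclid R n -> R) (X : euclid R n.+1) : R :=
  g [tuple of behead X].

Lemma tail_cons n (g : euclid R n -> R) x (X : euclid R n) :
  tail_fun g [tuple of x :: X] = g X.
Proof. by rewrite /tail_fun; congr g; exact: val_inj. Qed.

Lemma unit_tail n (g : euclid R n -> R) : unit_fun g -> unit_fun (tail_fun g).
Proof. by move=> ug; apply: (unit_fun_comp ug); exact: measurable_behead. Qed.

Lemma avg_tail n (g : euclid R n -> R) : avg (tail_fun g) = g.
Proof.
apply/funext => X; rewrite /avg; under eq_integral do rewrite tail_cons.
by rewrite integral_cstT.
Qed.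

(** The coordinates are perturbed independently and [mehler r x] has mean 1, so the first
    coordinate can be averaged out. In particular [f - tail_fun (avg f)] is orthogonal to
    every [tail_fun g] for the noise form. *)
Lemma noise_form_tail r n (f : euclid R n.+1 -> R) (g : euclid R n -> R) :
  (0 <= r < 1)%R -> unit_fun f -> unit_fun g ->
  noise_form r f (tail_fun g) = noise_form r (avg f) g.
Proof.
move=> r01 uf ug; have [mf f01] := uf; have [mg g01] := ug.
rewrite !noise_formE//; [|exact: unit_avg|exact: unit_tail].
have [mtg tg01] := unit_tail ug.
pose q X := \int[gam n]_Y (g Y * kernel r X Y)%:E.
have q0 X : 0 <= q X by rewrite /q; have [b /andP[b0 _] ->] := noise_operator_unit X r01 ug.
have qE x (X : euclid R n) :
    \int[gam n.+1]_Y (tail_fun g Y * kernel r [tuple of x :: X] Y)%:E = q X.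
  rewrite integral_gaussianS; first last.
  - by move=> Y; rewrite lee_fin mulr_ge0 ?kernel_ge0//; case/andP: (tg01 Y).
  - by apply/measurable_EFinP; apply: measurable_funM => //; exact: measurable_kernel.
  transitivity (\int[mu]_y (q X * (mehler r x y)%:E)).
    apply: eq_integral => y _; rewrite muleC -ge0_integralZlT.
    + by apply: eq_integral => Y _; rewrite tail_cons kernel_cons -EFinM mulrCA.
    + by apply/measurable_EFinP; apply: measurable_funM => //; exact: measurable_kernel.
    + by move=> Y; rewrite lee_fin mulr_ge0 ?kernel_ge0//; case/andP: (g01 Y).
    + by rewrite lee_fin mehler_ge0.
  rewrite ge0_integralZlT//; first by rewrite integral_mehler// mule1.
  + by apply/measurable_EFinP; exact: measurable_mehler.
  + by move=> y; rewrite lee_fin mehler_ge0.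
have mq m (h : euclid R m -> R) : unit_fun h ->
    measurable_fun setT (fun X => \int[gam m]_Y (h Y * kernel r X Y)%:E).
  move=> [mh h01]; apply: (measurable_integralr (gam m)
    (f := fun X Y => (h Y * kernel r X Y)%:E)).
    apply/measurable_EFinP; apply: measurable_funM; last exact: measurable_kernel.
    exact: measurableT_comp mh measurable_snd.
  by move=> X Y; rewrite lee_fin mulr_ge0 ?kernel_ge0//; case/andP: (h01 Y).
rewrite integral_gaussianSr; last 2 first.
- apply: emeasurable_funM; first exact/measurable_EFinP.
  by apply: mq; exact: unit_tail.
- move=> X; apply: mule_ge0; first by rewrite lee_fin; case/andP: (f01 X).
  apply: integral_ge0 => Y _; rewrite lee_fin mulr_ge0 ?kernel_ge0//.
  by case/andP: (tg01 Y).
apply: eq_integral => X _; under eq_integral do rewrite qE muleC.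
rewrite ge0_integralZlT//; first by rewrite avgE// muleC.
- by apply/measurable_EFinP; exact: measurableT_comp mf (measurable_consr X).
- by move=> x; rewrite lee_fin; case/andP: (f01 [tuple of x :: X]).
Qed.

Definition resample n (X : euclid R n) (i : 'I_n) (y : R) : euclid R n :=
  [tuple if j == i then y else tnth X j | j < n].

Lemma resample_head n x y (X : euclid R n) :
  resample [tuple of x :: X] ord0 y = [tuple of y :: X].
Proof.
apply/eq_from_tnth => j; rewrite tnth_mktuple.
by case: (unliftP ord0 j) => [k|] ->; rewrite ?tnthS ?tnth0// eqxx.
Qed.

Lemma resample_tail n x y (X : euclid R n) (i : 'I_n) :
  resample [tuple of x :: X] (lift ord0 i) y = [tuple of x :: resample X i y].
Proof.
apply/eq_from_tnth => j; rewrite tnth_mktuple.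
case: (unliftP ord0 j) => [k|] ->; rewrite ?tnthS ?tnth0//.
by rewrite tnth_mktuple (inj_eq lift_inj).
Qed.

Lemma measurable_resample n (i : 'I_n) d (T : measurableType d)
    (a : T -> euclid R n) (b : T -> measurableTypeR R) :
  measurable_fun setT a -> measurable_fun setT b ->
  measurable_fun setT (fun t => resample (a t) i (b t)).
Proof.
move=> ma mb; apply/measurable_fun_tnthP => j.
rewrite (_ : _ \o _ = fun t => if j == i then b t else tnth (a t) j); last first.
  by apply/funext => t /=; rewrite tnth_mktuple.
case: (j == i) => //.
have mt := @measurable_tnth _ (measurableTypeR R) n j.
exact: measurableT_comp mt ma.
Qed.

(** An L1 influence. It makes sense for all functions on R^n, whereas the geometric
    influence is attached to sets, and averaging over one coordinate does not increase the
    influences of the others ([l1_influence_tail]). This permits an induction on n that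
    leaves the indicator functions. *)
Definition l1_influence n (f : euclid R n -> R) (i : 'I_n) : \bar R :=
  \int[gam n]_X \int[mu]_y \int[mu]_z
    (`|f (resample X i y) - f (resample X i z)|)%:E.

Lemma measurable_l1_inner n (f : euclid R n -> R) (i : 'I_n) :
  measurable_fun setT f ->
  measurable_fun setT (fun X => \int[mu]_y \int[mu]_z
    (`|f (resample X i y) - f (resample X i z)|)%:E).
Proof.
move=> mf; apply: (measurable_integralr mu (f := fun (X : euclid R n) y =>
    \int[mu]_z (`|f (resample X i y) - f (resample X i z)|)%:E)).
  apply: (measurable_integralr mu (f := fun (p : euclid R n * measurableTypeR R) z =>
    (`|f (resample p.1 i p.2) - f (resample p.1 i z)|)%:E)).
    apply/measurable_EFinP; apply: measurableT_comp => //; apply: measurable_funB;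
      apply: measurableT_comp mf _; apply: measurable_resample.
    + exact: measurableT_comp measurable_fst measurable_fst.
    + exact: measurableT_comp measurable_snd measurable_fst.
    + exact: measurableT_comp measurable_fst measurable_fst.
    + exact: measurable_snd.
  by move=> p z; rewrite lee_fin.
by move=> X y; apply: integral_ge0 => z _; rewrite lee_fin.
Qed.

(** The value of f minus its average over the first coordinate is the mean, over z, of the
    difference between f and f with its first coordinate replaced by z. *)
Lemma l1_influence_head n (f : euclid R n.+1 -> R) : unit_fun f ->
  \int[gam n.+1]_X (`|f X - tail_fun (avg f) X|)%:E <= l1_influence f ord0.
Proof.
move=> uf; have [mf f01] := uf.
have [mt _] := unit_tail (unit_avg uf).
have mF : measurable_fun setT (fun q : (measurableTypeR R * euclid R n) * measurableTypeR R =>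
    (`|f [tuple of q.1.1 :: q.1.2] - f [tuple of q.2 :: q.1.2]|)%:E).
  apply/measurable_EFinP; apply: measurableT_comp => //; apply: measurable_funB.
    exact: measurableT_comp mf (measurable_cons
      (measurableT_comp measurable_fst measurable_fst)
      (measurableT_comp measurable_snd measurable_fst)).
  exact: measurableT_comp mf (measurable_cons measurable_snd
      (measurableT_comp measurable_snd measurable_fst)).
apply: (@le_trans _ _ (\int[gam n]_X \int[mu]_y \int[mu]_z
    (`|f [tuple of y :: X] - f [tuple of z :: X]|)%:E)).
  rewrite integral_gaussianSr; last 2 first.
  - by apply/measurable_EFinP; apply: measurableT_comp => //; exact: measurable_funB.
  - by move=> X; rewrite lee_fin.
  apply: le_integral_nonmeasurable => X.
    by apply: integral_ge0 => y _; rewrite lee_fin.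
  apply: le_integral_nonmeasurable => y; first by rewrite lee_fin.
  rewrite tail_cons.
  apply: (le_mean_abs (P := mu) (f := fun=> f [tuple of y :: X])
    (g := fun z => f [tuple of z :: X])).
  - by split => // t; exact: f01.
  - exact: (unit_fun_comp uf (measurable_consr X)).
  - by rewrite integral_cstT.
  - exact: avgE.
rewrite /l1_influence integral_gaussianS; first last.
- by move=> X; do 2 (apply: integral_ge0 => ? _); rewrite lee_fin.
- exact: (measurable_l1_inner ord0 mf).
under [leRHS]eq_integral => x _.
  under eq_integral => X _.
    under eq_integral => y _.
      under eq_integral => z _ do rewrite !resample_head.
      over.
    over.
  over.
by rewrite integral_cstT.
Qed.

(** The absolute value of a mean is at most the mean of the absolute values, applied to
    the average over the first coordinate x. The integral over x is then moved outside. *)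
Lemma l1_influence_tail n (f : euclid R n.+1 -> R) (i : 'I_n) : unit_fun f ->
  l1_influence (avg f) i <= l1_influence f (lift ord0 i).
Proof.
move=> uf; have [mf f01] := uf.
pose F (x : measurableTypeR R) (X : euclid R n) (y z : measurableTypeR R) : \bar R :=
  (`|f [tuple of x :: resample X i y] - f [tuple of x :: resample X i z]|)%:E.
have F0 x X y z : 0 <= F x X y z by rewrite lee_fin.
have mF d (T : measurableType d) (a : T -> measurableTypeR R) (b : T -> euclid R n)
    (c e : T -> measurableTypeR R) :
    measurable_fun setT a -> measurable_fun setT b -> measurable_fun setT c ->
    measurable_fun setT e -> measurable_fun setT (fun t => F (a t) (b t) (c t) (e t)).
  move=> ma mb mc me; apply/measurable_EFinP; apply: measurableT_comp => //.
  apply: measurable_funB; apply: measurableT_comp mf _; apply: measurable_cons => //;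
    exact: measurable_resample.
have mF1 : measurable_fun setT (fun q : (measurableTypeR R * euclid R n) =>
    \int[mu]_y \int[mu]_z F q.1 q.2 y z).
  apply: (measurable_integralr mu (f := fun (q : measurableTypeR R * euclid R n) y =>
    \int[mu]_z F q.1 q.2 y z)) => [|q y]; last exact: integral_ge0.
  apply: (measurable_integralr mu
    (f := fun (q : (measurableTypeR R * euclid R n) * measurableTypeR R) z =>
    F q.1.1 q.1.2 q.2 z)) => //.
  apply: mF => //.
  - exact: (measurableT_comp measurable_fst (measurableT_comp measurable_fst measurable_fst)).
  - exact: (measurableT_comp measurable_snd (measurableT_comp measurable_fst measurable_fst)).
  - exact: (measurableT_comp measurable_snd measurable_fst).
have -> : l1_influence f (lift ord0 i) =
    \int[gam n]_X \int[mu]_x \int[mu]_y \int[mu]_z F x X y z.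
  rewrite /l1_influence integral_gaussianS; first last.
  - by move=> X; do 2 (apply: integral_ge0 => ? _); rewrite lee_fin.
  - exact: (measurable_l1_inner (lift ord0 i) mf).
  rewrite (tonelli mu (gam n)); first last.
  - by move=> x X; do 2 (apply: integral_ge0 => ? _); rewrite lee_fin.
  - rewrite [X in measurable_fun _ X](_ : _ = fun q : (measurableTypeR R * euclid R n) =>
      \int[mu]_y \int[mu]_z F q.1 q.2 y z); first exact: mF1.
    apply/funext => q; apply: eq_integral => y _; apply: eq_integral => z _.
    by rewrite /F !resample_tail.
  apply: eq_integral => X _; apply: eq_integral => x _; apply: eq_integral => y _.
  by apply: eq_integral => z _; rewrite /F !resample_tail.
apply: le_integral_nonmeasurable => X.
  by do 2 (apply: integral_ge0 => ? _); rewrite lee_fin.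
rewrite -(tonelli3 mu mu mu (f := fun y z x => F x X y z)) //; last first.
  apply: mF => //.
  - exact: (measurableT_comp measurable_fst measurable_fst).
  - exact: (measurableT_comp measurable_snd measurable_fst).
apply: le_integral_nonmeasurable => y.
  by apply: integral_ge0 => ? _; rewrite lee_fin.
apply: le_integral_nonmeasurable => z; first by rewrite lee_fin.
apply: (le_mean_abs (P := mu) (f := fun x => f [tuple of x :: resample X i y])
  (g := fun x => f [tuple of x :: resample X i z])).
- exact: (unit_fun_comp uf (measurable_consr _)).
- exact: (unit_fun_comp uf (measurable_consr _)).
- exact: avgE.
- exact: avgE.
Qed.

End unit_functions.

(** * The bound under heavy noise *)

Section heavy_noise.
Variable R : realType.
Local Notation mu := (@normal_prob R 0 1).
Local Notation gam := (@gaussian R).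
Implicit Types r : R.
Local Open Scope ereal_scope.

(** The martingale increment of the first coordinate, in absolute value because
    [hypercontractive] is about nonnegative functions. *)
Definition increment n (f : euclid R n.+1 -> R) (X : euclid R n.+1) : R :=
  `|f X - tail_fun (avg f) X|%R.

Lemma unit_increment n (f : euclid R n.+1 -> R) : unit_fun f -> unit_fun (increment f).
Proof.
move=> uf; have [mf f01] := uf; have [mt t01] := unit_tail (unit_avg uf).
split; first by apply: measurableT_comp => //; exact: measurable_funB.
move=> X; rewrite /increment normr_ge0/= ler_norml.
have /andP[f0 f1] := f01 X; have /andP[g0 g1] := t01 X.
by apply/andP; split; lra.
Qed.

(** Pythagoras for the conditional expectation given the coordinates other than the
    first. *)
Lemma integral_increment_sqr n (f : euclid R n.+1 -> R) : unit_fun f ->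
  \int[gam n.+1]_X (increment f X ^+ 2)%:E + \int[gam n]_X (avg f X ^+ 2)%:E =
  \int[gam n.+1]_X (f X ^+ 2)%:E.
Proof.
move=> uf; have [mf f01] := uf; have [mg g01] := unit_avg uf.
have [md d01] := unit_increment uf.
have md2 : measurable_fun setT (fun X => (increment f X ^+ 2)%:E).
  by apply/measurable_EFinP; exact: measurable_funX.
rewrite !integral_gaussianSr//; first last.
- by move=> X; rewrite lee_fin sqr_ge0.
- by move=> X; rewrite lee_fin sqr_ge0.
- by apply/measurable_EFinP; exact: measurable_funX.
rewrite -ge0_integralDT; first last.
- by move=> X; rewrite lee_fin sqr_ge0.
- by apply/measurable_EFinP; exact: measurable_funX.
- by move=> X; apply: integral_ge0 => x _; rewrite lee_fin sqr_ge0.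
- apply: (measurable_integrall mu
    (f := fun x (X : euclid R n) => (increment f [tuple of x :: X] ^+ 2)%:E)).
    exact: measurableT_comp md2 (@measurable_cons2 R n).
  by move=> x X; rewrite lee_fin sqr_ge0.
apply: eq_integral => X _.
rewrite -(mean_variance (unit_fun_comp uf (measurable_consr X)) (avgE X uf)).
congr (_ + _); apply: eq_integral => x _ /=.
by rewrite /increment tail_cons real_normK ?num_real.
Qed.

Lemma l1_influence_ge0 n (f : euclid R n -> R) (i : 'I_n) : 0 <= l1_influence f i.
Proof. by do 3 (apply: integral_ge0 => ? _); rewrite lee_fin. Qed.

Lemma integral2D d1 d2 (T1 : measurableType d1) (T2 : measurableType d2)
    (m1 : {sigma_finite_measure set T1 -> \bar R})
    (m2 : {sigma_finite_measure set T2 -> \bar R}) (f g : T1 -> T2 -> \bar R) :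
  measurable_fun setT (fun p : T1 * T2 => f p.1 p.2) -> (forall x y, 0 <= f x y) ->
  measurable_fun setT (fun p : T1 * T2 => g p.1 p.2) -> (forall x y, 0 <= g x y) ->
  \int[m1]_x \int[m2]_y (f x y + g x y) =
  \int[m1]_x \int[m2]_y f x y + \int[m1]_x \int[m2]_y g x y.
Proof.
move=> mf f0 mg g0.
have sec (h : T1 -> T2 -> \bar R) x : measurable_fun setT (fun p : T1 * T2 => h p.1 p.2) ->
    measurable_fun setT (h x).
  by move=> mh; exact: measurableT_comp mh (pair1_measurable x).
rewrite -ge0_integralDT.
- apply: eq_integral => x _; rewrite ge0_integralDT//.
  + exact: sec.
  + exact: sec.
- exact: measurable_integralr.
- by move=> x; exact: integral_ge0.
- exact: measurable_integralr.
- by move=> x; exact: integral_ge0.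
Qed.

(** Write f = d + t with t = [tail_fun (avg f)]. By [noise_form_tail] the pairings of f with t
    and of t with t are both the noise form of [avg f], so the noise form of f is the one of d
    plus the one of [avg f]; replacing d by its absolute value can only increase it. *)
Lemma noise_form_increment r n (f : euclid R n.+1 -> R) : (0 <= r < 1)%R -> unit_fun f ->
  noise_form r f f <= noise_form r (increment f) (increment f) +
                      noise_form r (avg f) (avg f).
Proof.
move=> r01 uf; have ug := unit_avg uf; have ut := unit_tail ug.
have ud := unit_increment uf.
pose p (u v : euclid R n.+1 -> R) X Y : \bar R := (u X * v Y * kernel r X Y)%:E.
have p0 u v : unit_fun u -> unit_fun v -> forall X Y, 0 <= p u v X Y.
  move=> [_ u01] [_ v01] X Y; rewrite lee_fin mulr_ge0 ?kernel_ge0// mulr_ge0//.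
    by case/andP: (u01 X).
  by case/andP: (v01 Y).
have mp u v : unit_fun u -> unit_fun v ->
    measurable_fun setT (fun q : euclid R n.+1 * euclid R n.+1 => p u v q.1 q.2).
  by move=> [mu_ _] [mv _]; exact: measurable_noise_form.
set t := tail_fun (avg f) in ut *; set d := increment f in ud *.
have tt : noise_form r t t = noise_form r (avg f) (avg f).
  by rewrite (noise_form_tail r01 ut ug) avg_tail.
have ft : noise_form r f t = noise_form r (avg f) (avg f).
  exact: noise_form_tail r01 uf ug.
have tf : noise_form r t f = noise_form r (avg f) (avg f).
  by rewrite (noise_formC r ut uf).
(* The expansion of (f - t) (f - t) with the negative terms on the other side, which
   keeps all integrands nonnegative. *)
have main : noise_form r f f + noise_form r t t <=
    noise_form r d d + (noise_form r f t + noise_form r t f).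
  have mft := mp _ _ uf ut; have mtf := mp _ _ ut uf.
  have e1 : noise_form r f f + noise_form r t t =
      \int[gam n.+1]_X \int[gam n.+1]_Y (p f f X Y + p t t X Y).
    by rewrite (integral2D _ _ (mp _ _ uf uf) (p0 _ _ uf uf) (mp _ _ ut ut) (p0 _ _ ut ut)).
  have e2 : noise_form r f t + noise_form r t f =
      \int[gam n.+1]_X \int[gam n.+1]_Y (p f t X Y + p t f X Y).
    by rewrite (integral2D _ _ mft (p0 _ _ uf ut) mtf (p0 _ _ ut uf)).
  have e3 : noise_form r d d + \int[gam n.+1]_X \int[gam n.+1]_Y (p f t X Y + p t f X Y) =
      \int[gam n.+1]_X \int[gam n.+1]_Y (p d d X Y + (p f t X Y + p t f X Y)).
    rewrite (integral2D _ _ (mp _ _ ud ud) (p0 _ _ ud ud)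
       (f := p d d) (g := fun X Y => p f t X Y + p t f X Y)) //.
    - exact: emeasurable_funD mft mtf.
    - by move=> X Y; apply: adde_ge0; apply: p0.
  rewrite [leLHS]e1 [X in _ <= _ + X]e2 [leRHS]e3.
  apply: le_integral_nonmeasurable => X.
    by apply: integral_ge0 => Y _; apply: adde_ge0; apply: p0.
  apply: le_integral_nonmeasurable => Y.
    by apply: adde_ge0; apply: p0.
  rewrite /p -!EFinD lee_fin -!mulrDl ler_wpM2r ?kernel_ge0//.
  have dE Z : d Z = `|f Z - t Z|%R by [].
  rewrite !dE -normrM; have := ler_norm ((f X - t X) * (f Y - t Y))%R.
  by rewrite [X in (X <= _)%R -> _]mulrBl !mulrBr; lra.
have := noise_form_le1 r01 ug ug.
have : 0 <= noise_form r (avg f) (avg f).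
  have [_ g01] := ug; apply: integral_ge0 => X _; apply: integral_ge0 => Y _.
  rewrite lee_fin mulr_ge0 ?kernel_ge0// mulr_ge0//.
    by case/andP: (g01 X).
  by case/andP: (g01 Y).
move: main; rewrite tt ft tf.
case: (noise_form r (avg f) (avg f)) => [z| |]// main _ _.
move: main; rewrite addeA leeD2rE//.
Qed.

(** Under heavy noise, the covariance of f with its noisy copy is at most
    lam^3 (sum of the squared influences) + lam^-1 (variance of f). One coordinate is split
    off at a time. The increment contributes at most the product of its 4/3 and 2 norms
    ([hypercontractive]), hence lam^3 times the square of its L1 norm plus lam^-1 times the
    square of its L2 norm ([interpolate]). The first of these is bounded by the influence
    ([l1_influence_head]), and the second ones add up to the variance
    ([integral_increment_sqr]). *)
Lemma noise_bound r n (f : euclid R n -> R) (lam a s : R) :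
  (0 <= r <= 4^-1)%R -> (0 < lam)%R -> unit_fun f ->
  \int[gam n]_X (f X)%:E = a%:E -> \int[gam n]_X (f X ^+ 2)%:E = s%:E ->
  noise_form r f f + (lam^-1 * a ^+ 2)%:E <=
  (a ^+ 2 + lam^-1 * s)%:E + (lam ^+ 3)%:E * \sum_(i < n) l1_influence f i ^+ 2.
Proof.
move=> r4 l0; have l1 := ltW l0; have li : (0 <= lam^-1)%R by rewrite invr_ge0.
have r01 : (0 <= r < 1)%R by case/andP: r4 => -> /= ?; lra.
elim: n f a s => [|n IHn] f a s uf fa fs.
  rewrite big_ord0 mule0 adde0.
  move: fa fs; rewrite /noise_form !integral_gaussian0 => -[<-] [<-].
  by rewrite kernel_nil mulr1 -EFinD lee_fin -expr2.
have ug := unit_avg uf; have ud := unit_increment uf.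
have [A A01 dA] := unit_mean (gam n.+1) ud.
have [B _ dB] := unit_mean (gam n.+1) (unit_sqr ud).
have [sg _ gs] := unit_mean (gam n) (unit_sqr ug).
have ga : \int[gam n]_X (avg f X)%:E = a%:E by rewrite -integral_avg.
have IH := IHn _ _ _ ug ga gs.
have sE : s = (B + sg)%R.
  by have := integral_increment_sqr uf; rewrite dB gs fs -EFinD => -[<-].
have J0 : A%:E <= l1_influence f ord0 by rewrite -dA; exact: l1_influence_head.
have hyp : noise_form r (increment f) (increment f) <=
    (lam ^+ 3 * A ^+ 2 + lam^-1 * B)%:E.
  apply: le_trans (interpolate l0 ud dA dB).
  have [md d01] := ud.
  apply: (hypercontractive (C := 1) r4 (f := EFin \o increment f) (g := EFin \o increment f)).
  - exact/measurable_EFinP.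
  - by move=> X; rewrite /= !lee_fin.
  - exact/measurable_EFinP.
  - by move=> X; rewrite /= !lee_fin.
apply: le_trans (leeD2r _ (noise_form_increment r01 uf)) _.
rewrite -addeA; apply: le_trans (leeD hyp IH) _.
rewrite big_ord_recl ge0_muleDr; last 2 first.
- by apply: sqre_ge0.
- by apply: sume_ge0 => i _; exact: sqre_ge0.
rewrite addeA addeA; apply: leeD; last first.
  apply: lee_wpmul2l; first by rewrite lee_fin exprn_ge0.
  apply: lee_sum => i _; rewrite !expe2.
  exact: (lee_pmul (l1_influence_ge0 _ _) (l1_influence_ge0 _ _)
    (l1_influence_tail i uf) (l1_influence_tail i uf)).
apply: (@le_trans _ _ ((a ^+ 2 + lam^-1 * s)%:E + (lam ^+ 3)%:E * (A%:E ^+ 2))).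
  by rewrite -EFin_expe -EFinM -!EFinD lee_fin sE; lra.
apply: leeD; first exact: lexx.
apply: lee_wpmul2l; first by rewrite lee_fin exprn_ge0.
have A0 : 0 <= A%:E by case/andP: A01; rewrite lee_fin.
rewrite !expe2; exact: (lee_pmul A0 A0 J0 J0).
Qed.

End heavy_noise.

(** * Comparison of noise levels *)

Section log_convexity.
Variable R : realType.
Local Notation gam := (@gaussian R).
Implicit Types r : R.
Local Open Scope ereal_scope.

Lemma noise_form_fin r n (f : euclid R n -> R) : (0 <= r < 1)%R -> unit_fun f ->
  exists2 z : R, (0 <= z <= 1)%R & noise_form r f f = z%:E.
Proof.
move=> r01 uf; have I1 := noise_form_le1 r01 uf uf.
have I0 : 0 <= noise_form r f f.
  have [_ f01] := uf; apply: integral_ge0 => X _; apply: integral_ge0 => Y _.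
  rewrite lee_fin mulr_ge0 ?kernel_ge0// mulr_ge0//.
    by case/andP: (f01 X).
  by case/andP: (f01 Y).
move: I0 I1; case: (noise_form r f f) => [z| |]//; rewrite !lee_fin => z0 z1.
by exists z => //; rewrite z0.
Qed.

(** Let T be the noise operator of correlation r. Then z1 = <f, T f>, while T f has mean a,
    and its squared norm is z2 because T is symmetric with T T the operator of correlation r^2.
    So this is the Cauchy-Schwarz inequality for the centred functions f and T f. *)
Lemma noise_form_logconvex r n (f : euclid R n -> R) (a s z1 z2 : R) :
  (0 <= r < 1)%R -> unit_fun f ->
  \int[gam n]_X (f X)%:E = a%:E -> \int[gam n]_X (f X ^+ 2)%:E = s%:E ->
  noise_form r f f = z1%:E -> noise_form (r ^+ 2) f f = z2%:E ->
  [/\ (0 <= s - a ^+ 2)%R, (0 <= z2 - a ^+ 2)%R &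
      ((z1 - a ^+ 2) ^+ 2 <= (s - a ^+ 2) * (z2 - a ^+ 2))%R].
Proof.
move=> r01 uf fa fs z1E z2E; have [mf f01] := uf.
have f0 X : (0 <= f X)%R by case/andP: (f01 X).
pose h X := fine (\int[gam n]_Y (f Y * kernel r X Y)%:E).
have hE X : \int[gam n]_Y (f Y * kernel r X Y)%:E = (h X)%:E.
  by rewrite /h; have [q _ ->] := noise_operator_unit X r01 uf.
have h0 X : (0 <= h X)%R.
  by rewrite /h; have [q /andP[q0 _] ->] := noise_operator_unit X r01 uf.
have mfk : measurable_fun setT (fun p : euclid R n * euclid R n =>
    (f p.2 * kernel r p.1 p.2)%:E).
  apply/measurable_EFinP; apply: measurable_funM; last exact: measurable_kernel.
  exact: measurableT_comp mf measurable_snd.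
have fk0 X Y : 0 <= (f Y * kernel r X Y)%:E by rewrite lee_fin mulr_ge0 ?kernel_ge0.
have mfkX X : measurable_fun setT (fun Y => (f Y * kernel r X Y)%:E).
  by apply/measurable_EFinP; apply: measurable_funM => //; exact: measurable_kernel.
have mh : measurable_fun setT h.
  apply/measurable_EFinP; rewrite (_ : _ \o _ = fun X =>
    \int[gam n]_Y (f Y * kernel r X Y)%:E); last by apply/funext => X; rewrite hE.
  exact: (measurable_integralr (gam n) mfk fk0).
have ha : \int[gam n]_X (h X)%:E = a%:E.
  under eq_integral do rewrite -hE.
  rewrite (tonelli (gam n) (gam n) mfk fk0) -fa; apply: eq_integral => Y _.
  rewrite -[RHS]mule1 -(integral_kernel Y r01) -ge0_integralZlT.
  - by apply: eq_integral => X _; rewrite EFinM kernelC.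
  - by apply/measurable_EFinP; exact: measurable_kernel.
  - by move=> X; rewrite lee_fin kernel_ge0.
  - by rewrite lee_fin.
have hh : \int[gam n]_X (h X ^+ 2)%:E = z2%:E.
  rewrite -z2E /noise_form.
  pose F Y Z X : \bar R := (f Y * f Z * (kernel r X Y * kernel r X Z))%:E.
  have F0 Y Z X : 0 <= F Y Z X by rewrite lee_fin !mulr_ge0// kernel_ge0.
  have mF : measurable_fun setT (fun q : (euclid R n * euclid R n) * euclid R n =>
      F q.1.1 q.1.2 q.2).
    have m11 : measurable_fun setT
        (fun q : (euclid R n * euclid R n) * euclid R n => q.1.1).
      exact: (measurableT_comp measurable_fst measurable_fst).
    have m12 : measurable_fun setT
        (fun q : (euclid R n * euclid R n) * euclid R n => q.1.2).
      exact: (measurableT_comp measurable_snd measurable_fst).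
    apply/measurable_EFinP; apply: measurable_funM; apply: measurable_funM.
    - exact: measurableT_comp mf m11.
    - exact: measurableT_comp mf m12.
    - exact: measurable_kernel.
    - exact: measurable_kernel.
  transitivity (\int[gam n]_Y \int[gam n]_Z \int[gam n]_X F Y Z X).
    rewrite (tonelli3 (gam n) (gam n) (gam n) mF F0); apply: eq_integral => X _.
    rewrite expr2 EFinM -{1}hE muleC -ge0_integralZlT; last 3 first.
    - exact: mfkX.
    - exact: fk0.
    - by rewrite lee_fin.
    apply: eq_integral => Y _; rewrite -hE muleC -ge0_integralZlT.
    - by apply: eq_integral => Z _; rewrite /F -EFinM; congr EFin; ring.
    - exact: mfkX.
    - exact: fk0.
    - exact: fk0.
  apply: eq_integral => Y _; apply: eq_integral => Z _.
  rewrite EFinM -(kernel_semigroup Y Z r01) -ge0_integralZlT.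
  - by apply: eq_integral => X _; rewrite /F EFinM.
  - by apply/measurable_EFinP; apply: measurable_funM; exact: measurable_kernel.
  - by move=> X; rewrite lee_fin mulr_ge0 ?kernel_ge0.
  - by rewrite lee_fin mulr_ge0.
have fh : \int[gam n]_X (f X * h X)%:E = z1%:E.
  by rewrite -z1E (noise_formE r uf uf); apply: eq_integral => X _; rewrite EFinM hE.
have := covariance_sqr_le mf mh f0 h0 fa ha fs hh fh.
by rewrite -expr2.
Qed.

(** As the variance of f is at most 1, [noise_form_logconvex] gives v (r)^2 <= v (r^2) for the
    covariance v (r) = z1 - a^2, and this is iterated k times. The covariance is nonnegative
    because it is the variance of the image of f under the noise of correlation sqrt r. *)
Lemma noise_decay r n (f : euclid R n -> R) (a z1 z2 : R) k :
  (0 <= r < 1)%R -> unit_fun f -> \int[gam n]_X (f X)%:E = a%:E ->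
  noise_form r f f = z1%:E -> noise_form (r ^+ (2 ^ k)) f f = z2%:E ->
  (0 <= z1 - a ^+ 2)%R /\ ((z1 - a ^+ 2) ^+ (2 ^ k) <= z2 - a ^+ 2)%R.
Proof.
move=> r01 uf fa.
have [s s01 fs] := unit_mean (gam n) (unit_sqr uf).
have pos t z : (0 <= t < 1)%R -> noise_form t f f = z%:E -> (0 <= z - a ^+ 2)%R.
  move=> /andP[t0 t1] tz.
  have q01 : (0 <= Num.sqrt t < 1)%R by rewrite sqrtr_ge0/= -sqrtr1 ltr_sqrt.
  have [y _ yE] := noise_form_fin q01 uf.
  have zE : noise_form (Num.sqrt t ^+ 2) f f = z%:E by rewrite sqr_sqrtr.
  by have [] := noise_form_logconvex q01 uf fa fs yE zE.
elim: k r z1 r01 => [|k IHk] r z1 r01 z1E z2E.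
  have /eqP := z2E; rewrite expn0 expr1 z1E => /eqP[<-].
  by rewrite expr1; split=> //; exact: pos z1E.
have p1 := pos _ _ r01 z1E; split => //.
have rr : (0 <= r ^+ 2 < 1)%R.
  by case/andP: r01 => r0 r1; rewrite sqr_ge0 expr_lt1.
have [y _ yE] := noise_form_fin rr uf.
rewrite expnS exprM in z2E; have [y0 yk] := IHk _ _ rr yE z2E.
have [v0 _ lc] := noise_form_logconvex r01 uf fa fs z1E yE.
rewrite expnS exprM; apply: le_trans yk; rewrite lerXn2r ?nnegrE ?sqr_ge0//.
apply: (le_trans lc); rewrite ler_piMl//.
by case/andP: s01 => _ s1; have := sqr_ge0 a; lra.
Qed.

End log_convexity.

(** * From fibres to the theorem *)

Section conclusion.
Variable R : realType.
Local Notation mu := (@normal_prob R 0 1).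
Local Notation gam := (@gaussian R).

Lemma unit_indic n (A : set (euclid R n)) : measurable A -> unit_fun (\1_A : _ -> R).
Proof.
move=> mA; split; first exact: measurable_indic.
by move=> X; rewrite indicE; case: (X \in A); rewrite ?ler01 ?lexx.
Qed.

Lemma indic_resample n (A : set (euclid R n)) (i : 'I_n) (X : euclid R n) y :
  \1_A (resample X i y) = \1_(fiber A i X) y :> R.
Proof. by rewrite !indicE; congr (nat_of_bool _)%:R; apply/idP/idP; rewrite !inE. Qed.

Lemma measurable_fiber n (A : set (euclid R n)) (i : 'I_n) (X : euclid R n) :
  measurable A -> measurable (fiber A i X).
Proof.
move=> mA; have mr : measurable_fun setT (fun y : measurableTypeR R => resample X i y).
  exact: measurable_resample.
by have := mr measurableT A mA; rewrite setTI.
Qed.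

Lemma integral_indic_diff (S : set (measurableTypeR R)) : measurable S ->
  (\int[mu]_y \int[mu]_z (`|\1_S y - \1_S z|)%:E = 2%:E * (mu S * mu (~` S)))%E.
Proof.
move=> mS; have mC : measurable (~` S) by exact: measurableC.
have mp (C D : set (measurableTypeR R)) : measurable C -> measurable D ->
    measurable_fun setT (fun p : measurableTypeR R * measurableTypeR R =>
      (\1_C p.1)%:E * (\1_D p.2 : R)%:E)%E.
  have mi E : measurable E ->
      measurable_fun setT (fun x : measurableTypeR R => (\1_E x : R)%:E).
    by move=> mE; apply/measurable_EFinP; exact: measurable_indic.
  move=> mC' mD; apply: emeasurable_funM.
    exact: measurableT_comp (mi _ mC') measurable_fst.
  exact: measurableT_comp (mi _ mD) measurable_snd.
have p0 (C D : set (measurableTypeR R)) (x y : measurableTypeR R) :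
    (0 <= (\1_C x)%:E * (\1_D y : R)%:E)%E by rewrite mule_ge0// lee_fin.
transitivity (\int[mu]_y \int[mu]_z ((\1_S y)%:E * (\1_(~` S) z)%:E +
    (\1_(~` S) y)%:E * (\1_S z)%:E))%E.
  apply: eq_integral => y _; apply: eq_integral => z _.
  rewrite -!EFinM -EFinD !indicE !in_setC.
  case: (y \in S); case: (z \in S); rewrite /= ?subrr ?subr0 ?sub0r ?normr0 ?normrN ?normr1;
    by rewrite ?mulr0 ?mul0r ?mulr1 ?addr0 ?add0r.
rewrite (integral2D mu mu (mp _ _ mS mC) (p0 _ _) (mp _ _ mC mS) (p0 _ _)).
rewrite !integral2_indic// [X in (_ + X)%E]muleC.
by rewrite -mule2n -mule_natl.
Qed.

(** On each fibre the mean of |1_S y - 1_S z| is 2 mu (S) mu (~` S), to which the Cheeger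
    inequality applies. The fibrewise comparison is integrated by
    [le_integral_nonmeasurable], so the constant is first moved to the left-hand side,
    where the integrand is Borel. *)
Lemma l1_influence_le_geometric n (A : set (euclid R n)) (i : 'I_n) : measurable A ->
  (l1_influence (\1_A : _ -> R) i <=
   (2 * cheeger_cst R)%:E * geometric_influence A i)%E.
Proof.
move=> mA; have c0 : 0 < cheeger_cst R by exact: lt_le_trans (cheeger_cst_ge1 R).
have d0 : 0 < 2 * cheeger_cst R by rewrite mulr_gt0.
rewrite -lee_pdivrMl//; have [mI _] := unit_indic mA.
rewrite -ge0_integralZlT; first last.
- by rewrite lee_fin invr_ge0 ltW.
- by move=> X; do 2 (apply: integral_ge0 => ? _); rewrite lee_fin.
- exact: (measurable_l1_inner i mI).
apply: le_integral_nonmeasurable => X.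
  apply: mule_ge0; first by rewrite lee_fin invr_ge0 ltW.
  by do 2 (apply: integral_ge0 => ? _); rewrite lee_fin.
rewrite lee_pdivrMl//.
under eq_integral => y _.
  under eq_integral => z _ do rewrite !indic_resample.
  over.
have mF := measurable_fiber i X mA.
rewrite integral_indic_diff// EFinM -muleA lee_wpmul2l ?lee_fin//.
exact: gaussian_cheeger.
Qed.

(** Conditioning on W turns the noisy copy into a kernel ([integral_noisy_kernel]). *)
Lemma Z_gauss_noise_form n (A : set (euclid R n)) (rho : R) :
  0 < rho < 1 -> measurable A ->
  Z_gauss A rho = noise_form (Num.sqrt (1 - rho ^+ 2)) (\1_A : _ -> R) \1_A.
Proof.
move=> rho01 mA; have uA := unit_indic mA; have [mI i01] := uA.
rewrite (noise_formE _ uA uA) /Z_gauss.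
have mZ : measurable_fun setT (fun p : euclid R n * euclid R n =>
    ((\1_A p.1 : R) * \1_A (noisy rho p.1 p.2))%:E).
  apply/measurable_EFinP; apply: measurable_funM.
    exact: measurableT_comp mI measurable_fst.
  by apply: measurableT_comp mI _; exact: measurable_noisy.
have Z0 (X U : euclid R n) : (0 <= ((\1_A X : R) * \1_A (noisy rho X U))%:E)%E.
  by rewrite lee_fin mulr_ge0.
rewrite (tonelli_prod (gam n) (gam n) (f := fun X U =>
  ((\1_A X : R) * \1_A (noisy rho X U))%:E) mZ Z0).
apply: eq_integral => X _.
have i0 (Y : euclid R n) : (0 <= (\1_A Y : R)%:E)%E by rewrite lee_fin.
have mIE : measurable_fun setT (fun Y : euclid R n => (\1_A Y : R)%:E).
  exact/measurable_EFinP.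
under [in RHS]eq_integral do rewrite EFinM.
rewrite -(integral_noisy_kernel X rho01 mIE i0) -ge0_integralZlT.
- by apply: eq_integral => U _; rewrite EFinM.
- by apply/measurable_EFinP; apply: measurableT_comp mI _; exact: measurable_noisy.
- by move=> U; exact: i0.
- exact: i0.
Qed.

Lemma exp_onem_bernoulli (x : R) m : 0 <= x <= 1 ->
  (1 - x) ^+ m * (1 + m%:R * x) <= 1.
Proof.
move=> /andP[x0 x1]; elim: m => [|m IHm]; first by rewrite expr0 mul0r addr0 mulr1.
apply: le_trans IHm; rewrite exprSr -mulrA ler_wpM2l ?exprn_ge0 ?subr_ge0//.
rewrite -natr1; have : 0 <= m%:R * x * x by rewrite !mulr_ge0.
have : 0 <= x * x by rewrite mulr_ge0.
move: (m%:R : R) => M; nra.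
Qed.

(** Take k = j + 1 for the least j such that 2^j rho^2 >= 3. The power of r is then
    (1 - rho^2)^(2^j), at most 1 / (1 + 2^j rho^2) <= 1/4; and minimality of j gives
    2^j rho^2 < 6. *)
Lemma doubling_exponent (rho : R) : 0 < rho < 1 ->
  exists k, Num.sqrt (1 - rho ^+ 2) ^+ (2 ^ k) <= 4^-1 /\ (2 ^ k)%:R * rho ^+ 2 <= 12.
Proof.
move=> /andP[rho0 rho1]; have r20 : 0 < rho ^+ 2 by rewrite exprn_gt0.
have r21 : rho ^+ 2 <= 1 by rewrite expr_le1// ltW.
have ex : exists j, 3 <= (2 ^ j)%:R * rho ^+ 2.
  exists (Num.truncn (3 / rho ^+ 2)).+1; rewrite -ler_pdivrMr//.
  apply: le_trans (ltW (truncnS_gt _)) _.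
  by rewrite ler_nat ltnW// ltn_expl.
have [j j3 jmin] := ex_minnP ex; exists j.+1; split.
  rewrite expnS exprM sqr_sqrtr ?subr_ge0//.
  have /exp_onem_bernoulli : 0 <= rho ^+ 2 <= 1 by rewrite ltW.
  move=> /(_ (2 ^ j)%N); have : 0 <= (1 - rho ^+ 2) ^+ (2 ^ j).
    by rewrite exprn_ge0// subr_ge0.
  move: j3; move: ((1 - rho ^+ 2) ^+ (2 ^ j)) ((2 ^ j)%:R * rho ^+ 2) => x y; nra.
case: j j3 jmin => [|j] j3 jmin; first by move: j3; rewrite expn0 mul1r; lra.
have : (2 ^ j)%:R * rho ^+ 2 < 3.
  by rewrite ltNge; apply/negP => /jmin; rewrite ltnn.
rewrite !expnS !natrM; move: ((2 ^ j)%:R : R) => y; nra.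
Qed.

(** The choice lam = S^(-1/4) makes both terms equal to S^(1/4); for S = 0, let lam grow. *)
Lemma optimize_lambda (w S : R) : 0 <= S ->
  (forall lam, 0 < lam -> w <= lam ^+ 3 * S + lam^-1) -> w <= 2 * S `^ 4^-1.
Proof.
rewrite le_eqVlt => /predU1P[<-|S0] wl.
  rewrite powR0 ?invr_eq0// mulr0; apply/ler_addgt0Pr => e e0.
  by rewrite add0r; have := wl e^-1; rewrite invr_gt0 invrK mulr0 add0r; exact.
set q := S `^ 4^-1; have q0 : 0 < q by exact: powR_gt0.
have qS : q ^+ 4 = S by rewrite -powR_mulrn ?powR_ge0// -powRrM mulVf// powRr1// ltW.
have := wl q^-1; rewrite invr_gt0 invrK => /(_ q0) /le_trans; apply.
rewrite -{1}qS exprVn (_ : (q ^+ 3)^-1 * q ^+ 4 = q); last by field; rewrite gt_eqF.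
by rewrite mulr_natl mulr2n.
Qed.

(** Undoing the N-th power costs an exponent 1 / N, which is at least rho^2 / 12. Since
    0 <= v <= 1, v is at most (v^N)^(rho^2 / 12), and combined with the fourth root of the
    preceding optimization the exponent is rho^2 / 48. The constant 2 D >= 1 only decreases
    when raised to the power rho^2 / 12 <= 1. *)
Lemma root_bound (v w S t D rho : R) (N : nat) :
  0 < rho < 1 -> N%:R * rho ^+ 2 <= 12 -> 1 <= D -> 0 <= v <= 1 -> v ^+ N <= w ->
  w <= 2 * S `^ 4^-1 -> 0 <= S -> 0 <= t -> S <= D ^+ 2 * t ->
  v <= (2 * D) * t `^ (48^-1 * rho ^+ 2).
Proof.
move=> /andP[rho0 rho1] N12 D1 /andP[v0 v1] vw wS S0 t0 St.
have D0 : 0 <= D by exact: le_trans D1.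
set th := rho ^+ 2 / 12; have th0 : 0 <= th by rewrite divr_ge0// sqr_ge0.
have th1 : th <= 1.
  have : rho ^+ 2 <= 1 by rewrite expr_le1// ltW.
  by rewrite /th ler_pdivrMr// mul1r => r1; lra.
have vN : v <= (v ^+ N) `^ th.
  rewrite -powR_mulrn// -powRrM.
  have [->|vn0] := eqVneq v 0; first exact: powR_ge0.
  rewrite -[leLHS]powRr1//; apply: ger_powR; first by rewrite lt0r vn0 v0.
  by rewrite /th mulrA ler_pdivrMr// mul1r.
apply: (le_trans vN).
have b : v ^+ N <= (2 * D) * t `^ 4^-1.
  apply: (le_trans vw); apply: (le_trans wS); rewrite -mulrA ler_wpM2l//.
  apply: (@le_trans _ _ ((D ^+ 2 * t) `^ 4^-1)).
    by apply: ge0_ler_powR; rewrite ?nnegrE ?invr_ge0// mulr_ge0 ?sqr_ge0.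
  rewrite powRM ?sqr_ge0// ler_wpM2r ?powR_ge0//.
  rewrite -powR_mulrn// -powRrM -[leRHS]powRr1//; apply: ler_powR => //.
  by rewrite ler_pdivrMr//; lra.
apply: (@le_trans _ _ (((2 * D) * t `^ 4^-1) `^ th)).
  by apply: ge0_ler_powR => //; rewrite nnegrE ?exprn_ge0// !mulr_ge0 ?powR_ge0.
rewrite powRM ?powR_ge0 ?mulr_ge0// -powRrM.
rewrite (_ : 4^-1 * th = 48^-1 * rho ^+ 2); last by rewrite /th; field.
rewrite ler_wpM2r ?powR_ge0// -[leRHS]powRr1 ?mulr_ge0//.
by apply: ler_powR => //; lra.
Qed.

End conclusion.

Theorem theorem1p9 (R : realType) :
  exists C1 C2 : R, [/\ 0 < C1, 0 < C2 &
    forall (n : nat), (1 <= n)%N ->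
    forall (A : set (euclid R n)), measurable A ->
    forall (rho : R), 0 < rho < 1 ->
      (VAR_gauss A rho <=
       C1%:E * (\sum_(i < n) geometric_influence A i ^+ 2) `^ (C2 * rho ^+ 2))%E].
Proof.
pose D : R := 2 * cheeger_cst R.
have D1 : 1 <= D by have := cheeger_cst_ge1 R; rewrite /D; lra.
have D0 : 0 < D by exact: lt_le_trans D1.
exists (2 * D), 48^-1; split; [by rewrite mulr_gt0|by []|].
move=> n _ A mA rho rho01; have uA := unit_indic mA.
have /andP[rho0 rho1] := rho01.
have r2 : 0 < rho ^+ 2 < 1 by rewrite exprn_gt0//= expr_lt1// ltW.
pose r := Num.sqrt (1 - rho ^+ 2).
have r01 : 0 <= r < 1.
  by rewrite sqrtr_ge0/= -[ltRHS]sqrtr1 ltr_sqrt//; case/andP: r2 => *; lra.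
set T := (\sum_(i < n) geometric_influence A i ^+ 2)%E.
have T0 : (0 <= T)%E by apply: sume_ge0 => i _; exact: sqre_ge0.
have [k [rk kN]] := doubling_exponent rho01.
have [z1 _ z1E] := noise_form_fin r01 uA.
have rk01 : 0 <= r ^+ (2 ^ k) < 1.
  have /andP[r0 _] := r01; rewrite exprn_ge0//=.
  by apply: le_lt_trans rk _; lra.
have rk4 : 0 <= r ^+ (2 ^ k) <= 4^-1 by case/andP: rk01 => ->.
have [z2 _ z2E] := noise_form_fin rk01 uA.
have [a _ fa] := unit_mean (gaussian R n) uA.
have [s s01 fs] := unit_mean (gaussian R n) (unit_sqr uA).
have [v0 vN] := noise_decay r01 uA fa z1E z2E.
have VE : VAR_gauss A rho = (z1 - a ^+ 2)%:E.
  rewrite /VAR_gauss (Z_gauss_noise_form rho01 mA) -/r z1E.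
  have -> : gaussian R n A = a%:E by rewrite -fa integral_indicT.
  by rewrite -EFin_expe EFinB.
rewrite VE.
have z1le : z1 <= 1.
  by rewrite -lee_fin -z1E; exact: noise_form_le1.
have S0 : (0 <= \sum_(i < n) l1_influence (\1_A : _ -> R) i ^+ 2)%E.
  by apply: sume_ge0 => i _; exact: sqre_ge0.
have ST : (\sum_(i < n) l1_influence (\1_A : _ -> R) i ^+ 2 <= (D ^+ 2)%:E * T)%E.
  rewrite /T ge0_sume_distrr; last by move=> i _; exact: sqre_ge0.
  apply: lee_sum => i _.
  have h := l1_influence_le_geometric i mA; have h0 := l1_influence_ge0 (\1_A : _ -> R) i.
  rewrite !expe2 expr2 EFinM muleACA.
  exact: (lee_pmul h0 h0 h h).
have wl := fun lam (l0 : 0 < lam) => noise_bound rk4 l0 uA fa fs.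
rewrite z2E in wl.
move: S0 ST wl T0.
move: (\sum_(i < n) l1_influence (\1_A : _ -> R) i ^+ 2)%E => S.
(* An infinite influence makes the right-hand side infinite. *)
case: T => [t| |//]; last first.
  move=> _ _ _ _; rewrite poweRyr; last first.
    by rewrite mulf_neq0// ?invr_eq0// gt_eqF//; case/andP: r2.
  by rewrite gt0_muley ?leey// lte_fin mulr_gt0.
case: S => [S| |//]; last by rewrite -EFinM.
rewrite -EFinM !lee_fin => S0 ST wl t0.
apply: (root_bound (N := (2 ^ k)%N) (w := z2 - a ^+ 2) (S := S)) => //.
  by rewrite v0/=; have := sqr_ge0 a; lra.
apply: optimize_lambda => // lam l0.
have := wl lam l0; rewrite -EFinD -EFinM -EFinD lee_fin.
have : 0 <= lam^-1 * a ^+ 2 by rewrite mulr_ge0 ?sqr_ge0// invr_ge0 ltW.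
have : lam^-1 * s <= lam^-1.
  by have /andP[_ s1] := s01; rewrite ler_piMr// invr_ge0 ltW.
lra.
Qed.
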